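(* Let $Q$ be a complete connected Riemannian manifold with distance $d$, let $s\ge2$, $T>0$, let $\mathbb{G}=(\mathcal{V},\mathcal{E})$ be an undirected graph on $\mathcal{V}=\{1,\dots,s\}$, and fix boundary data $q_i^0,q_i^T\in Q$, $v_i^0\in T_{q_i^0}Q$, $v_i^T\in T_{q_i^T}Q$. Let $R_{ij}>0$, $(i,j)\in\mathcal{E}$, be tolerances (symmetric in $(i,j)$) for which collision avoidance is feasible. Then for all tolerances $0<r_{ij}<R_{ij}$ (symmetric in $(i,j)$), $(i,j)\in\mathcal{E}$, there exist $\epsilon_{ij}\in\mathbb{R}^+$ and $k_{ij}\in\mathbb{N}$ (symmetric in $(i,j)$) such that every minimizer of $J$ with the potentials $V_{ij}=V_{R_{ij},\epsilon_{ij}}^{k_{ij}}$, $(i,j)\in\mathcal{E}$, avoids collision with tolerances $r_{ij}$.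
   Context: $\|\cdot\|$ is the norm of the metric on $Q$, $\frac{D}{dt}$ is covariant differentiation along curves (Levi-Civita connection), and $\frac{D^2q}{dt^2}=\frac{D}{dt}\dot q$. $\mathcal{E}\subseteq\mathcal{V}\times\mathcal{V}$ is symmetric and $\mathcal{N}_i=\{j:(i,j)\in\mathcal{E}\}$ (other agents, so $i\notin\mathcal{N}_i$). $\Omega=\Omega_1\times\cdots\times\Omega_s$, where $\Omega_i$ is the set of $C^1$ piecewise smooth curves $q_i:[0,T]\to Q$ with $q_i(0)=q_i^0$, $\dot q_i(0)=v_i^0$, $q_i(T)=q_i^T$, $\dot q_i(T)=v_i^T$. $$J(q_1,\dots,q_s)=\frac12\sum_{i=1}^s\int_0^T\Big(\Big\|\frac{D^2q_i}{dt^2}(t)\Big\|^2+\frac12\sum_{j\in\mathcal{N}_i}V_{ij}(q_i(t),q_j(t))\Big)dt.$$ A minimizer of $J$ is $q^*\in\Omega$ with $J(q^* )\le J(\omega)$ for all $\omega\in\Omega$. For $D,\epsilon\in\mathbb{R}^+$ and $k\in\mathbb{N}$: $V_{D,\epsilon}^k(p,q)=\dfrac{1}{\epsilon+(d(p,q)/D)^k}$. A trajectory $q\in\Omega$ avoids collision with tolerances $\rho_{ij}>0$ if $d(q_i(t),q_j(t))\ge\rho_{ij}$ for all $(i,j)\in\mathcal{E}$ and $t\in[0,T]$. Collision avoidance with tolerances $\rho_{ij}$ is feasible if some $q\in\Omega$ avoids collision with tolerances $\rho_{ij}$. *)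

(* Defs.v *)
From mathcomp Require Import all_boot all_order all_algebra.
From mathcomp Require Import all_classical all_reals all_analysis.

Set Implicit Arguments.
Unset Strict Implicit.
Unset Printing Implicit Defensive.

Import Order.TTheory GRing.Theory Num.Theory.
Import numFieldNormedType.Exports.

Local Open Scope classical_set_scope.
Local Open Scope ring_scope.

(* In finite dimension (the only case used below) continuity of every
   directional derivative is continuity of the differential, so this is the
   usual class C^k on an open set U. *)
Fixpoint Ck (R : realType) (V W : normedModType R) (k : nat)
    (U : set V) (f : V -> W) : Prop :=
  if k is k'.+1 then
    (forall x, U x -> differentiable f x) /\
    (forall v : V, Ck k' U (fun x => 'D_v f x))
  else forall x, U x -> {for x, continuous f}.

Definition smooth_on (R : realType) (V W : normedModType R)
    (U : set V) (f : V -> W) : Prop :=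
  forall k, Ck k U f.

Record chart (R : realType) (n : nat) (Q : topologicalType) := Chart {
  chart_dom : set Q;
  chart_fun :> Q -> 'rV[R]_n;
  chart_inv : 'rV[R]_n -> Q;
  chart_dom_open : open chart_dom;
  chart_codom_open : open (chart_fun @` chart_dom);
  chart_funK : forall p, chart_dom p -> chart_inv (chart_fun p) = p;
  chart_fun_continuous :
    forall p, chart_dom p -> {for p, continuous chart_fun};
  chart_inv_continuous :
    forall x, (chart_fun @` chart_dom) x -> {for x, continuous chart_inv}
}.

(* The smooth structure is presented by an atlas with one chart [chart_at p]
   selected around each point p; every maximal atlas contains such a family and
   is determined by it. *)
Record smoothManifold (R : realType) (n : nat) := SmoothManifold {
  carrier :> topologicalType;
  chart_at : carrier -> chart R n carrier;
  carrier_hausdorff : hausdorff_space carrier;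
  carrier_second_countable : @second_countable carrier;
  chart_at_dom : forall p, chart_dom (chart_at p) p;
  chart_at_smooth : forall p q : carrier,
    smooth_on
      (chart_at p @` (chart_dom (chart_at p) `&` chart_dom (chart_at q)))
      (chart_at q \o chart_inv (chart_at p))
}.

(* T_pM is represented by 'rV[R]_n: a tangent vector at p is given by its
   components in the preferred chart [chart_at p]. *)
Definition tangent (R : realType) (n : nat) (M : smoothManifold R n) (p : M) :
  Type := 'rV[R]_n.

(* Components in [chart_at c'] of the vector at p whose components in
   [chart_at c] are v: the differential at p of the transition map. *)
Definition change_chart (R : realType) (n : nat) (M : smoothManifold R n)
    (c c' p : M) (v : 'rV[R]_n) : 'rV[R]_n :=
  'D_v (chart_at c' \o chart_inv (chart_at c)) (chart_at c p).

(* Components of a bilinear form g along the coordinate fields of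
   [chart_at c], as a function of the coordinates x; [g p] is the Gram matrix
   of the form on T_pM. *)
Definition gram (R : realType) (n : nat) (M : smoothManifold R n)
    (g : M -> 'M[R]_n) (c : M) (x : 'rV[R]_n) : 'M[R]_n :=
  let p := chart_inv (chart_at c) x in
  let X (i : 'I_n) := change_chart c p p (delta_mx 0 i) in
  \matrix_(i, j) (X i *m g p *m (X j)^T) 0 0.

Record riemannianManifold (R : realType) (n : nat) := RiemannianManifold {
  manifold_of :> smoothManifold R n;
  metric : manifold_of -> 'M[R]_n;
  metric_sym : forall p, (metric p)^T = metric p;
  metric_pos : forall p (v : 'rV[R]_n),
    v != 0 -> 0 < (v *m metric p *m v^T) 0 0;
  metric_smooth : forall c : manifold_of,
    smooth_on (chart_at c @` chart_dom (chart_at c)) (gram metric c)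
}.

(* Derivative at t relative to [a, b]: two-sided inside, one-sided at a, b. *)
Definition deriv_on (R : realType) (W : normedModType R) (a b : R)
    (f : R -> W) (t : R) : W :=
  lim ((fun h => h^-1 *: (f (t + h) - f t)) @
         within [set h | t + h \in `[a, b]] 0^').

Section Riemannian.
Context (R : realType) (n : nat) (Q : riemannianManifold R n).

Definition tnorm (p : Q) (v : tangent p) : R :=
  Num.sqrt ((v *m metric p *m v^T) 0 0).

(* Christoffel symbols Gamma^k_ij of the Levi-Civita connection in the
   chart [chart_at c], at the point with coordinates x. *)
Definition christoffel (c : Q) (x : 'rV[R]_n) (k i j : 'I_n) : R :=
  let G := gram (@metric R n Q) c in
  2^-1 * \sum_(l < n) invmx (G x) k l *
    ('D_(delta_mx 0 i) (fun y => G y j l) x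
     + 'D_(delta_mx 0 j) (fun y => G y i l) x
     - 'D_(delta_mx 0 l) (fun y => G y i j) x).

(* Curves on [a, b] are functions on R of which only the values on [a, b]
   matter.  Regularity on the closed interval is local extendability, in
   coordinates, to a function of the given class on an open set of R. *)
Definition regular_curve (reg : set R -> (R -> 'rV[R]_n) -> Prop)
    (a b : R) (q : R -> Q) : Prop :=
  forall t, t \in `[a, b] -> exists (U : set R) (x : R -> 'rV[R]_n),
    [/\ open U, U t, reg U x &
        forall u, U u -> u \in `[a, b] ->
          chart_dom (chart_at (q t)) (q u) /\ chart_at (q t) (q u) = x u].

Definition C1_curve : R -> R -> (R -> Q) -> Prop :=
  regular_curve (fun U x => Ck 1 U x).

Definition smooth_curve : R -> R -> (R -> Q) -> Prop :=
  regular_curve (fun U x => smooth_on U x).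

Definition piecewise (curve : R -> R -> (R -> Q) -> Prop)
    (a b : R) (q : R -> Q) : Prop :=
  exists s : seq R, itv_partition a b s /\
    forall i, (i < size s)%N -> curve (nth b (a :: s) i) (nth b s i) q.

Definition velocity (a b : R) (q : R -> Q) (t : R) : tangent (q t) :=
  deriv_on a b (fun u => chart_at (q t) (q u)) t.

(* (DX/dt)^k = (X^k)' + Gamma^k_ij(q) (q^i)' X^j, all components being taken in
   the chart [chart_at (q t)]. *)
Definition cov_deriv (a b : R) (q : R -> Q) (X : forall u, tangent (q u))
    (t : R) : tangent (q t) :=
  let c := q t in
  let x u := chart_at c (q u) in
  let xi u := change_chart (q u) c (q u) (X u) in
  \row_k (deriv_on a b xi t 0 k +
          \sum_(i < n) \sum_(j < n)
             christoffel c (x t) k i j * deriv_on a b x t 0 i * xi t 0 j).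

Definition acceleration (a b : R) (q : R -> Q) (t : R) : tangent (q t) :=
  cov_deriv a b (velocity a b q) t.

(* The velocity of a piecewise C^1 curve may fail to exist at finitely many
   times, which the integral ignores; likewise for the acceleration in [cost]. *)
Definition curve_length (a b : R) (q : R -> Q) : R :=
  \int[lebesgue_measure]_(t in `[a, b]) tnorm (velocity a b q t).

Definition dist (p q : Q) : R :=
  inf [set l | exists (a b : R) (w : R -> Q),
    [/\ a < b, piecewise C1_curve a b w, w a = p, w b = q &
        l = curve_length a b w]].

Definition complete_manifold : Prop :=
  forall u : nat -> Q,
    (forall e : R, 0 < e -> exists N : nat, forall m k : nat,
       (N <= m)%N -> (N <= k)%N -> dist (u m) (u k) < e) ->
    exists p : Q, (fun m => dist (u m) p) @ \oo --> (0 : R).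

Section Agents.
Context (s : nat) (T : R) (E : rel 'I_s).

Definition admissible (q0 qT : 'I_s -> Q)
    (v0 : forall i, tangent (q0 i)) (vT : forall i, tangent (qT i))
    (q : 'I_s -> R -> Q) : Prop :=
  forall i,
    [/\ C1_curve 0 T (q i), piecewise smooth_curve 0 T (q i),
        q i 0 = q0 i /\ velocity 0 T (q i) 0 = v0 i :> 'rV[R]_n &
        q i T = qT i /\ velocity 0 T (q i) T = vT i :> 'rV[R]_n].

(* Extended-real valued, the integrand being nonnegative for V >= 0, so that no
   junk value arises from a divergent integral. *)
Definition cost (V : 'I_s -> 'I_s -> Q -> Q -> R) (q : 'I_s -> R -> Q) :
    \bar R :=
  ((2^-1)%:E * \sum_(i < s) \int[lebesgue_measure]_(t in `[0%R, T])
     (tnorm (acceleration 0 T (q i) t) ^+ 2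
      + 2^-1 * \sum_(j < s | E i j) V i j (q i t) (q j t))%R%:E)%E.

Definition minimizer (Omega : set ('I_s -> R -> Q))
    (J : ('I_s -> R -> Q) -> \bar R) (q : 'I_s -> R -> Q) : Prop :=
  Omega q /\ forall w, Omega w -> (J q <= J w)%E.

Definition avoids_collision (rho : 'I_s -> 'I_s -> R) (q : 'I_s -> R -> Q) :
    Prop :=
  forall i j t, E i j -> t \in `[0, T] -> rho i j <= dist (q i t) (q j t).

Definition avoidance_feasible (Omega : set ('I_s -> R -> Q))
    (rho : 'I_s -> 'I_s -> R) : Prop :=
  exists2 q, Omega q & avoids_collision rho q.

End Agents.

Definition potential (D eps : R) (k : nat) (p q : Q) : R :=
  (eps + (dist p q / D) ^+ k)^-1.

End Riemannian.

(* Main.v *)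
(* A feasible configuration has potential terms at most 1 whatever the
   parameters, so every minimizer satisfies J <= C with C independent of
   epsilon and k.  This bounds the L^2 norms of the accelerations, hence, as
   (1 + |q'|^2)^(1/2) has derivative at most |D^2q/dt^2|, the speeds by some L
   depending only on C, T and the initial velocities.  Thus d(q_i, q_j) is
   2L-Lipschitz in time: if it drops below r < R, it stays below (r + R)/2 < R on
   an interval of definite length, where the potential is as large as we please
   for epsilon small and k large, contradicting J <= C.

   That C is finite requires the acceleration of a smooth curve, defined chart by
   chart, to be bounded; this rests on its norm being independent of the chart.
   Integrands are not shown to be measurable: for nonnegative functions the
   library integral is a supremum over simple functions from below, which is
   monotone and additive over disjoint measurable sets in any case. *)
Require Import Defs.
From mathcomp Require Import all_boot all_order all_algebra.
From mathcomp Require Import all_classical all_reals all_analysis.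
From mathcomp Require Import measurable_realfun ring lra.

Set Implicit Arguments.
Unset Strict Implicit.
Unset Printing Implicit Defensive.

Import Order.TTheory GRing.Theory Num.Theory.
Import numFieldNormedType.Exports.
Local Open Scope classical_set_scope.
Local Open Scope ring_scope.

(** The chart in which [acceleration] is written changes with the point of the curve, so neither
    continuity nor boundedness can be read off its definition. The proof lowers the index: the
    covector <D^2q/dt^2, .> is the Euler-Lagrange expression of the energy, free of Christoffel
    symbols, and its covariance comes down to the symmetry of the second derivatives of transition
    maps. In a fixed chart, the squared norm is this covector paired with itself by the inverse Gram
    matrix, which is continuous in time; paired with the velocity, the covector gives half the
    derivative of |q'|^2.

    The L^2 bound on A = |D^2q/dt^2| becomes a bound on the speed through A <= 1 + A^2: the 1
    contributes at most T, and the cost controls the rest.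

    As [inf] of the empty set is 0, a small [dist] means nearness only where some joining curve is
    known. One exists at time 0, where all admissible trajectories agree and the feasible one has
    positive distances; it is then carried along both trajectories.

    Epsilon and k are functions of the numbers R_ij and r_ij alone, hence symmetric in (i,j). *)

(** * The integral of nonnegative, possibly non-measurable functions *)

Section LowerIntegral.
Local Open Scope ereal_scope.
Import HBNNSimple.
Context d (T : measurableType d) (R : realType) (mu : {measure set T -> \bar R}).
Implicit Types (A B D : set T) (f g : T -> \bar R).

Lemma ge0_integral_sup D f : (forall x, D x -> 0 <= f x) ->
  \int[mu]_(x in D) f x = ereal_sup [set sintegral mu h |
    h in [set h : {nnsfun T >-> R} | forall x, (h x)%:E <= (f \_ D) x]].
Proof. exact: ge0_integralE. Qed.

Lemma ge0_le_integral_lower D f g : (forall x, D x -> 0 <= f x) ->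
  (forall x, D x -> f x <= g x) ->
  \int[mu]_(x in D) f x <= \int[mu]_(x in D) g x.
Proof.
move=> f0 fg.
have g0 x : D x -> 0 <= g x by move=> Dx; exact: le_trans (f0 x Dx) (fg x Dx).
rewrite !ge0_integral_sup//; apply: ereal_sup_le => _ [h /= hf <-]; exists h => //= x.
apply: le_trans (hf x) _; rewrite /patch; case: ifPn => // /[!inE]; exact: fg.
Qed.

(** A simple function below [f] on the union vanishes elsewhere and is the sum of its restrictions
    to [A] and [B]; conversely, by disjointness, simple functions below [f] on [A] and on [B] add up
    to one below [f] on the union. *)
Lemma ge0_integral_setU_lower A B f : measurable A -> measurable B ->
  (forall x, (A `|` B) x -> 0 <= f x) -> A `&` B = set0 ->
  \int[mu]_(x in A `|` B) f x = \int[mu]_(x in A) f x + \int[mu]_(x in B) f x.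
Proof.
move=> mA mB f0 AB.
have fA0 x : A x -> 0 <= f x by move=> ?; apply: f0; left.
have fB0 x : B x -> 0 <= f x by move=> ?; apply: f0; right.
have patch_ge0 D x : (forall x, D x -> 0 <= f x) -> 0 <= (f \_ D) x.
  by move=> D0; rewrite /patch; case: ifPn => // /[!inE]; exact: D0.
apply/eqP; rewrite eq_le; apply/andP; split.
  rewrite ge0_integral_sup//; apply: ge_ereal_sup => _ [h /= hf <-].
  have -> : sintegral mu h = sintegral mu (proj_nnsfun h mA) +
                             sintegral mu (proj_nnsfun h mB).
    rewrite -sintegralD; apply: eq_sintegral => x /=; rewrite !mindicE -mulrDr.
    have := hf x; rewrite /patch in_setU.
    have [xA|xA] := boolP (x \in A); have [xB|xB] := boolP (x \in B) => /=.
    - by move: xA xB; rewrite !inE => xA xB; have : (A `&` B) x by []; rewrite AB.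
    - by rewrite addr0 mulr1.
    - by rewrite add0r mulr1.
    - rewrite lee_fin => h0; rewrite addr0 mulr0; apply/eqP.
      by rewrite eq_le h0 fun_ge0.
  apply: leeD; rewrite ge0_integral_sup//; apply: ereal_sup_ubound.
  - exists (proj_nnsfun h mA) => //= x; rewrite mindicE.
    have := hf x; rewrite /patch in_setU.
    by case: (x \in A) => /= hfx; rewrite (mulr1, mulr0).
  - exists (proj_nnsfun h mB) => //= x; rewrite mindicE.
    have := hf x; rewrite /patch in_setU.
    by case: (x \in B) => /=; rewrite ?orbT => hfx; rewrite (mulr1, mulr0).
have intAB := @integral_ge0 _ _ _ mu A f fA0.
rewrite [X in X + _]ge0_integral_sup//; set S := [set _ | _ in _].
rewrite [X in _ + X]ge0_integral_sup//; set S' := [set _ | _ in _].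
set I := integral _ _ _.
have key u v : S u -> S' v -> u + v <= I.
  move=> [h /= hf <-] [k /= kf <-]; rewrite /I ge0_integral_sup//.
  rewrite -sintegralD; apply: ereal_sup_ubound; exists (add_nnsfun h k) => //= x.
  move: (hf x) (kf x); rewrite /patch in_setU EFinD.
  have [xA|xA] := boolP (x \in A); have [xB|xB] := boolP (x \in B) => /= h1 k1.
  - by move: xA xB; rewrite !inE => xA xB; have : (A `&` B) x by []; rewrite AB.
  - by rewrite -[leRHS]adde0; apply: leeD.
  - by rewrite -[leRHS]add0e; apply: leeD.
  - by rewrite -[leRHS]adde0; apply: leeD.
have [->|Ioo] := eqVneq I +oo; first by rewrite leey.
have Ifin : I \is a fin_num by rewrite ge0_fin_numE ?lt_neqAle ?Ioo ?leey// integral_ge0.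
have S0 : S 0 by exists nnsfun0; [move=> x; exact: patch_ge0 | exact: sintegral0].
have S'0 : S' 0 by exists nnsfun0; [move=> x; exact: patch_ge0 | exact: sintegral0].
(* With [I] finite, the two suprema are taken one after the other by subtraction. *)
have supS' u : S u -> ereal_sup S' <= I - u.
  move=> Su; apply: ge_ereal_sup => v S'v.
  have ufin : u \is a fin_num.
    rewrite ge0_fin_numE.
      apply: (@le_lt_trans _ _ I); last by rewrite ltey_eq Ifin.
      by rewrite -[leLHS]adde0; exact: key.
    by case: Su => h _ <-; exact: sintegral_ge0.
  by rewrite leeBrDr// addeC; exact: key.
have supS'fin : ereal_sup S' \is a fin_num.
  rewrite ge0_fin_numE; last exact: ereal_sup_ubound.
  apply: (@le_lt_trans _ _ (I - 0)); first exact: supS'.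
  by rewrite sube0 ltey_eq Ifin.
rewrite -leeBrDr//; apply: ge_ereal_sup => u Su.
have ufin : u \is a fin_num.
  rewrite ge0_fin_numE.
    apply: (@le_lt_trans _ _ I); last by rewrite ltey_eq Ifin.
    by rewrite -[leLHS]adde0; exact: key.
  by case: Su => h _ <-; exact: sintegral_ge0.
by rewrite leeBrDr// addeC -leeBrDr//; exact: supS'.
Qed.

Lemma ge0_subset_integral_lower A B f : measurable A -> measurable B ->
  (forall x, B x -> 0 <= f x) -> A `<=` B ->
  \int[mu]_(x in A) f x <= \int[mu]_(x in B) f x.
Proof.
move=> mA mB f0 AB; rewrite -(setDUK AB) ge0_integral_setU_lower//.
- by rewrite leeDl// integral_ge0// => x [Bx _]; exact: f0.
- exact: measurableD.
- by rewrite setDUK.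
- by rewrite setDE setICA setICr setI0.
Qed.

End LowerIntegral.

Section LowerIntegralItv.
Local Open Scope ereal_scope.
Context (R : realType).
Notation mu := (@lebesgue_measure R).
Implicit Types (a b c : R) (f : R -> \bar R).

Lemma ge0_integral_itv_oc_cc a b f : (a <= b)%R ->
  (forall x, x \in `[a, b] -> 0 <= f x) ->
  \int[mu]_(x in `[a, b]) f x = \int[mu]_(x in `]a, b]) f x.
Proof.
move=> ab f0.
have E : `[a, b]%classic = [set a] `|` `]a, b].
  by apply/esym/(@setU1itv _ _ (BRight b) a false); rewrite bnd_simp.
rewrite E ge0_integral_setU_lower//=; first by rewrite integral_set1 add0e.
- by move=> x abx; apply: f0; have : `[a, b]%classic x by rewrite E.
- by apply/seteqP; split=> x //= [->]; rewrite in_itv/= ltxx.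
Qed.

Lemma ge0_integral_itv_oo_cc a b f : (a <= b)%R ->
  (forall x, x \in `[a, b] -> 0 <= f x) ->
  \int[mu]_(x in `[a, b]) f x = \int[mu]_(x in `]a, b[) f x.
Proof.
move=> leab f0; rewrite ge0_integral_itv_oc_cc//.
move: leab; rewrite le_eqVlt => /predU1P[ab|ab].
  by rewrite ab set_itvoc0 set_itvoo0.
have E : `]a, b]%classic = `]a, b[ `|` [set b].
  by apply/esym/(@setUitv1 _ _ (BRight a) b true); rewrite bnd_simp.
rewrite E ge0_integral_setU_lower//=; first by rewrite integral_set1 adde0.
- move=> x abx; have : `]a, b]%classic x by rewrite E.
  by rewrite /= in_itv/= => /andP[ax xb]; apply: f0; rewrite in_itv/= (ltW ax).
- by apply/seteqP; split=> x //= [+ xb]; rewrite xb in_itv/= ltxx andbF.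
Qed.

Lemma ge0_integral_itv_split a b c f : (a <= b <= c)%R ->
  (forall x, x \in `[a, c] -> 0 <= f x) ->
  \int[mu]_(x in `[a, c]) f x =
  \int[mu]_(x in `[a, b]) f x + \int[mu]_(x in `[b, c]) f x.
Proof.
move=> /andP[ab bc] f0.
have f0ab x : x \in `[a, b] -> 0 <= f x.
  by rewrite in_itv/= => /andP[ax xb]; apply: f0; rewrite in_itv/= ax (le_trans xb).
have f0bc x : x \in `[b, c] -> 0 <= f x.
  by rewrite in_itv/= => /andP[bx xc]; apply: f0; rewrite in_itv/= xc (le_trans ab).
have E : `[a, c]%classic = `[a, b] `|` `]b, c].
  by rewrite (@itv_bndbnd_setU _ _ _ (BRight b)) ?bnd_simp.
rewrite [X in _ = _ + X]ge0_integral_itv_oc_cc//.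
rewrite E ge0_integral_setU_lower//.
- by move=> x abx; apply: f0; have : `[a, c]%classic x by rewrite E.
- by apply/seteqP; split=> x //=; rewrite !in_itv/= => -[/andP[_ +] /andP[+ _]]; case: ltgtP.
Qed.

End LowerIntegralItv.

(** * Derivatives and limits *)

Section Calculus.
Context (R : realType).
Implicit Types (V W : normedModType R).

(** Reduces one-sided derivatives at the endpoints to ordinary derivatives of a local extension [y].
    As [a < b], the filter defining [deriv_on] is proper, so its limit is unique. *)
Lemma deriv_onE W (a b t : R) (f y : R -> W) : a < b -> t \in `[a, b] ->
  (\forall u \near t, u \in `[a, b] -> f u = y u) -> derivable y t 1 ->
  deriv_on a b f t = 'D_1 y t.
Proof.
move=> ab; rewrite in_itv/= => /andP[at_ tb] fy dy; rewrite /deriv_on.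
set F := within _ _.
have PF : ProperFilter F.
  apply: Build_ProperFilter; rewrite /F /within /= => -[e /= e0 Ae].
  (* At most half the length of [[a, b]]: depending on the half that contains [t], either [t + h] or
     [t - h] stays in the interval. *)
  pose h := Num.min (e / 2) ((b - a) / 2).
  have h0 : 0 < h by rewrite lt_min !divr_gt0//= subr_gt0.
  have he : h < e.
    by rewrite (@le_lt_trans _ _ (e / 2)) ?ge_min ?lexx// ltr_pdivrMr// ltr_pMr// ltr1n.
  have hba : h <= (b - a) / 2 by rewrite ge_min lexx orbT.
  have [tm|tm] := leP t ((a + b) / 2).
    apply: (Ae h); first by rewrite /= sub0r normrN gtr0_norm.
      by rewrite gt_eqF.
    by rewrite in_itv/=; apply/andP; split; lra.
  apply: (Ae (- h)); first by rewrite /= sub0r opprK gtr0_norm.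
    by rewrite oppr_eq0 gt_eqF.
  by rewrite in_itv/=; apply/andP; split; lra.
apply: cvg_lim => //.
have dy' : (fun h => h^-1 *: (y (t + h) - y t)) @ 0^' --> 'D_1 y t.
  have -> : (fun h => h^-1 *: (y (t + h) - y t)) =
      (fun h => h^-1 *: ((y \o shift t) (h *: 1) - y t)).
    apply/funext => h /=; have -> : h *: (1 : R) = h by exact: mulr1.
    by rewrite (addrC t h).
  exact: dy.
have ft : f t = y t by apply: (nbhs_singleton fy); rewrite in_itv/= at_.
apply: (fun H => cvg_trans H
  (@cvg_within_filter _ _ _ _ _ _ [set h | t + h \in `[a, b]] dy')).
apply: near_eq_cvg.
have fy0 : \forall h \near (0 : R), t + h \in `[a, b] -> f (t + h) = y (t + h).
  apply: (@cvgD _ _ _ _ _ (cst t) id t 0 (cvg_cst t) cvg_id (fun u => u \in `[a, b] -> f u = y u)).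
  by rewrite addr0.
rewrite /F /prop_near1 /within/= /nbhs/=.
apply: cvg_within.
move: fy0; apply: filterS => h + th; rewrite ft => -> //.
Qed.

End Calculus.

(** * Limits and derivatives of matrix-valued functions *)

Section MatrixCalculus.
Context (R : realType).

Lemma cvg_mxP (T : Type) (F : set_system T) {FF : Filter F} m n
    (f : T -> 'M[R]_(m, n)) (A : 'M[R]_(m, n)) :
  f @ F --> A <-> forall i j, (fun t => f t i j) @ F --> A i j.
Proof.
split=> [fA i j|fA].
  exact: (cvg_comp f (fun M : 'M[R]_(m, n) => M i j) fA (@coord_continuous R m n i j A)).
apply/cvgrPdist_le => /= e e0; near=> t.
rewrite /Num.Def.normr/= mx_normrE (bigmax_le _ (ltW e0))//= => i _.
rewrite !mxE; move: i; near: t; apply: filter_forall => -[i j] /=.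
by have /cvgrPdist_le := fA i j; exact.
Unshelve. all: by end_near. Qed.

Lemma cvg_sum (T : Type) (F : set_system T) {FF : Filter F} (I : Type)
    (s : seq I) (P : pred I) (W : normedModType R) (f : I -> T -> W) (l : I -> W) :
  (forall i, P i -> f i @ F --> l i) ->
  (fun t => \sum_(i <- s | P i) f i t) @ F --> \sum_(i <- s | P i) l i.
Proof. by move=> fl; apply: cvg_big => //; exact: add_continuous. Qed.

Lemma cvg_prod (T : Type) (F : set_system T) {FF : Filter F} (I : Type)
    (s : seq I) (P : pred I) (f : I -> T -> R) (l : I -> R) :
  (forall i, P i -> f i @ F --> l i) ->
  (fun t => \prod_(i <- s | P i) f i t) @ F --> \prod_(i <- s | P i) l i.
Proof. by move=> fl; apply: cvg_big => //; exact: mul_continuous. Qed.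

Lemma cvg_mulmx (T : Type) (F : set_system T) {FF : Filter F} m n p
    (f : T -> 'M[R]_(m, n)) (g : T -> 'M[R]_(n, p)) (A : 'M[R]_(m, n)) (B : 'M[R]_(n, p)) :
  f @ F --> A -> g @ F --> B -> (fun t => f t *m g t) @ F --> A *m B.
Proof.
move=> /cvg_mxP fA /cvg_mxP gB; apply/cvg_mxP => i j.
rewrite mxE; under eq_fun do rewrite mxE.
by apply: cvg_sum => k _; apply: cvgM.
Qed.

Lemma cvg_trmx (T : Type) (F : set_system T) {FF : Filter F} m n
    (f : T -> 'M[R]_(m, n)) (A : 'M[R]_(m, n)) :
  f @ F --> A -> (fun t => (f t)^T) @ F --> A^T.
Proof.
move=> /cvg_mxP fA; apply/cvg_mxP => i j; rewrite mxE.
by under eq_fun do rewrite mxE; exact: fA.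
Qed.

Lemma cvg_det (T : Type) (F : set_system T) {FF : Filter F} n
    (f : T -> 'M[R]_n) (A : 'M[R]_n) :
  f @ F --> A -> (fun t => \det (f t)) @ F --> \det A.
Proof.
move=> /cvg_mxP fA; apply: cvg_sum => s _.
by apply: cvgM; [exact: cvg_cst | apply: cvg_prod => i _].
Qed.

(** Cramer's rule: where it exists, the inverse is the adjugate divided by the determinant, both
    polynomial in the entries. *)
Lemma cvg_invmx (T : Type) (F : set_system T) {FF : Filter F} n
    (f : T -> 'M[R]_n) (A : 'M[R]_n) : (\forall t \near F, f t \in unitmx) ->
  A \in unitmx -> f @ F --> A -> (fun t => invmx (f t)) @ F --> invmx A.
Proof.
move=> fU AU fA.
have adjA : (fun t => (\det (f t))^-1 *: \adj (f t)) @ F --> (\det A)^-1 *: \adj A.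
  apply: cvgZ.
    by apply: cvgV; [rewrite -unitfE; exact: AU | exact: cvg_det].
  apply/cvg_mxP => i j; rewrite mxE; under eq_fun do rewrite mxE.
  apply: cvgM; first exact: cvg_cst.
  apply: cvg_det; apply/cvg_mxP => k l; rewrite !mxE; under eq_fun do rewrite !mxE.
  by move/cvg_mxP : fA; exact.
rewrite {2}/invmx AU; apply: cvg_trans adjA; apply: near_eq_cvg.
by apply: filterS fU => t fU; rewrite /invmx fU.
Qed.

Lemma is_derive_mulmx (V : normedModType R) m n p (f : V -> 'M[R]_(m, n))
    (g : V -> 'M[R]_(n, p)) x v df dg :
  is_derive x v f df -> is_derive x v g dg ->
  is_derive x v (fun u => f u *m g u) (df *m g x + f x *m dg).
Proof.
move=> [fx <-] [gx <-].
have fx' := (derivable_mxP _ _ _).1 fx; have gx' := (derivable_mxP _ _ _).1 gx.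
have D i j : is_derive x v (fun u => (f u *m g u) i j)
    (('D_v f x *m g x + f x *m 'D_v g x) i j).
  have -> : (fun u => (f u *m g u) i j) = \sum_k (fun u => f u i k * g u k j).
    by apply/funext => u; rewrite mxE fct_sumE.
  apply: is_derive_eq.
    apply: is_derive_sum => k; apply: is_deriveM; exact: derivableP.
  rewrite !mxE -big_split/=; apply: eq_bigr => k _.
  rewrite (derive_mx fx) (derive_mx gx) !mxE /GRing.scale/= addrC.
  by congr (_ + _); rewrite mulrC.
have dfg : derivable (fun u => f u *m g u) x v.
  by apply/derivable_mxP => i j; have [] := D i j.
apply: DeriveDef => //; rewrite (derive_mx dfg); apply/matrixP => i j.
by rewrite mxE; have [_] := D i j.
Qed.

Lemma is_derive_trmx (V : normedModType R) m n (f : V -> 'M[R]_(m, n)) x v df :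
  is_derive x v f df -> is_derive x v (fun u => (f u)^T) df^T.
Proof.
move=> [fx <-]; have dfT : derivable (fun u => (f u)^T) x v.
  apply/derivable_mxP => i j; under eq_fun do rewrite mxE.
  exact: (derivable_mxP _ _ _).1.
apply: DeriveDef => //; rewrite (derive_mx dfT); apply/matrixP => i j.
by rewrite !mxE (derive_mx fx) mxE; congr ('D_v _ x); apply/funext => u; rewrite mxE.
Qed.

Lemma is_derive_coord (V : normedModType R) m n (f : V -> 'M[R]_(m, n)) x v df i j :
  is_derive x v f df -> is_derive x v (fun u => f u i j) (df i j).
Proof.
move=> [fx <-]; apply: DeriveDef; first exact: (derivable_mxP _ _ _).1.
by rewrite (derive_mx fx) mxE.
Qed.

Lemma is_derive_chain (U V W : normedModType R) (f : U -> V) (g : V -> W) x v :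
  differentiable f x -> differentiable g (f x) ->
  is_derive x v (g \o f) ('D_('D_v f x) g (f x)).
Proof.
move=> df dg; have dgf : differentiable (g \o f) x by exact: differentiable_comp.
apply: DeriveDef; first exact: diff_derivable.
by rewrite deriveE// diff_comp//= deriveE// deriveE.
Qed.

Lemma differentiable_mx (V : normedModType R) m n (f : V -> 'M[R]_(m, n)) x :
  (forall i j, differentiable (fun u => f u i j) x) -> differentiable f x.
Proof.
move=> df.
have -> : f = \sum_i \sum_j (fun u => f u i j *: delta_mx i j).
  apply/funext => u; rewrite fct_sumE [LHS]matrix_sum_delta.
  by apply: eq_bigr => i _; rewrite fct_sumE.
by apply: differentiable_sum => i; apply: differentiable_sum => j; exact: differentiableZl.
Qed.

End MatrixCalculus.

(** * Symmetry of second derivatives *)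

Section ClassCk.
Context (R : realType).

Lemma is_derive_line (V W : normedModType R) (f : V -> W) (z v : V) (s : R) :
  derivable f (s *: v + z) v ->
  is_derive s 1 (fun s => f (s *: v + z)) ('D_v f (s *: v + z)).
Proof.
have E : (fun h : R => h^-1 *: (((fun s => f (s *: v + z)) \o shift s) (h *: (1 : R)) -
           f (s *: v + z))) =
         (fun h : R => h^-1 *: ((f \o shift (s *: v + z)) (h *: v) - f (s *: v + z))).
  apply/funext => h /=; have -> : h *: (1 : R) = h by exact: mulr1.
  by rewrite scalerDl addrA.
by move=> df; apply: DeriveDef; rewrite /derivable /derive E.
Qed.

#[local] Opaque derive.

(** The mean value theorem twice: for the increment of [f] along [h *: w] as a function of the
    coefficient of [v], then for the resulting increment of ['D_v f] along [w]. *)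
Lemma second_difference (V : normedModType R) (f : V -> R) (x v w : V) (h : R) :
  0 < h ->
  (forall s t, 0 <= s <= h -> 0 <= t <= h ->
     derivable f (s *: v + (t *: w + x)) v /\
     derivable ('D_v f) (t *: w + (s *: v + x)) w) ->
  exists s t, [/\ 0 <= s <= h, 0 <= t <= h &
    f (h *: v + (h *: w + x)) - f (h *: w + x) - f (h *: v + x) + f x =
    h * h * 'D_w ('D_v f) (t *: w + (s *: v + x))].
Proof.
move=> h0 df.
have h00 : (0 : R) <= 0 <= h by rewrite lexx ltW.
have hhh : (0 : R) <= h <= h by rewrite lexx ltW.
have dphi s : 0 <= s <= h ->
    is_derive s 1 (fun s => f (s *: v + (h *: w + x)) - f (s *: v + x))
      ('D_v f (s *: v + (h *: w + x)) - 'D_v f (s *: v + x)).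
  move=> s0h; apply: is_deriveB; apply: is_derive_line; first by have [] := df s h s0h hhh.
  by have [] := df s 0 s0h h00; rewrite scale0r add0r.
have [s s0h sE] : exists2 s, s \in `]0, h[ & (f (h *: v + (h *: w + x)) - f (h *: v + x)) -
    (f (0 *: v + (h *: w + x)) - f (0 *: v + x)) =
    ('D_v f (s *: v + (h *: w + x)) - 'D_v f (s *: v + x)) * (h - 0).
  apply: (@MVT _ (fun s => f (s *: v + (h *: w + x)) - f (s *: v + x))
      (fun s => 'D_v f (s *: v + (h *: w + x)) - 'D_v f (s *: v + x)) 0 h h0).
    by move=> s; rewrite in_itv/= => /andP[s0 sh]; apply: dphi; rewrite !ltW.
  apply: derivable_within_continuous => s; rewrite in_itv/= => s0h.
  by have [] := dphi s s0h.
have {}s0h : 0 <= s <= h by move: s0h; rewrite in_itv/= => /andP[? ?]; rewrite !ltW.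
have dpsi t : 0 <= t <= h ->
    is_derive t 1 (fun t => 'D_v f (t *: w + (s *: v + x)))
      ('D_w ('D_v f) (t *: w + (s *: v + x))).
  by move=> t0h; apply: is_derive_line; have [] := df s t s0h t0h.
have [t t0h tE] : exists2 t, t \in `]0, h[ & 'D_v f (h *: w + (s *: v + x)) -
    'D_v f (0 *: w + (s *: v + x)) = 'D_w ('D_v f) (t *: w + (s *: v + x)) * (h - 0).
  apply: (@MVT _ (fun t => 'D_v f (t *: w + (s *: v + x)))
      (fun t => 'D_w ('D_v f) (t *: w + (s *: v + x))) 0 h h0).
    by move=> t; rewrite in_itv/= => /andP[t0 th]; apply: dpsi; rewrite !ltW.
  apply: derivable_within_continuous => t; rewrite in_itv/= => t0h.
  by have [] := dpsi t t0h.
have {}t0h : 0 <= t <= h by move: t0h; rewrite in_itv/= => /andP[? ?]; rewrite !ltW.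
exists s, t; split => //; move: sE tE; rewrite !scale0r !add0r !subr0 => sE tE.
transitivity (f (h *: v + (h *: w + x)) - f (h *: v + x) - (f (h *: w + x) - f x)).
  by ring.
by rewrite sE [s *: v + (h *: w + x)]addrCA tE; ring.
Qed.

(** The second difference is symmetric in [v] and [w], so after division by d^2 it is a value of
    either mixed derivative at some point near [x]; continuity at [x] concludes. *)
Lemma derive_comm_scalar (V : normedModType R) (U : set V) (f : V -> R) (x v w : V) :
  open U -> U x ->
  (forall y, U y -> [/\ derivable f y v, derivable f y w,
     derivable ('D_v f) y w & derivable ('D_w f) y v]) ->
  {for x, continuous ('D_w ('D_v f))} -> {for x, continuous ('D_v ('D_w f))} ->
  'D_w ('D_v f) x = 'D_v ('D_w f) x.
Proof.
move=> oU Ux df cvw cwv.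
have key e : 0 < e -> `|'D_w ('D_v f) x - 'D_v ('D_w f) x| <= e.
  move=> e0.
  have lim3 (a b : V) : (fun p : R * R => p.1 *: a + (p.2 *: b + x)) @ ((0 : R), (0 : R)) --> x.
    rewrite -[X in _ --> X](_ : 0 *: a + (0 *: b + x) = x); last by rewrite !scale0r !add0r.
    have c1 : (fun p : R * R => p.1 *: a) @ ((0 : R), (0 : R)) --> (0 : R) *: a.
      by apply: cvgZ; [exact: cvg_fst | exact: cvg_cst].
    have c2 : (fun p : R * R => p.2 *: b) @ ((0 : R), (0 : R)) --> (0 : R) *: b.
      by apply: cvgZ; [exact: cvg_snd | exact: cvg_cst].
    apply: cvgD; [exact: c1 | apply: cvgD; [exact: c2 | exact: cvg_cst]].
  have nb (a b : V) : {for x, continuous ('D_b ('D_a f))} ->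
     \forall p \near ((0 : R), (0 : R)), U (p.1 *: a + (p.2 *: b + x)) /\
     `|'D_b ('D_a f) x - 'D_b ('D_a f) (p.1 *: a + (p.2 *: b + x))| <= e / 2.
    move=> cab; near=> p; split.
      by near: p; apply: lim3; exact: open_nbhs_nbhs.
    near: p; apply: (lim3 a b (fun y => `|'D_b ('D_a f) x - 'D_b ('D_a f) y| <= e / 2)).
    by have /cvgrPdist_le := cab; apply; rewrite divr_gt0.
  have [d d0 nbd] : exists2 d : R, 0 < d & forall s t, 0 <= s <= d -> 0 <= t <= d ->
    [/\ U (s *: v + (t *: w + x)), U (s *: w + (t *: v + x)),
     `|'D_w ('D_v f) x - 'D_w ('D_v f) (t *: w + (s *: v + x))| <= e / 2 &
     `|'D_v ('D_w f) x - 'D_v ('D_w f) (t *: v + (s *: w + x))| <= e / 2].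
    have : \forall p \near ((0 : R), (0 : R)), (U (p.1 *: v + (p.2 *: w + x)) /\
     `|'D_w ('D_v f) x - 'D_w ('D_v f) (p.1 *: v + (p.2 *: w + x))| <= e / 2) /\
     (U (p.1 *: w + (p.2 *: v + x)) /\
     `|'D_v ('D_w f) x - 'D_v ('D_w f) (p.1 *: w + (p.2 *: v + x))| <= e / 2).
      exact: (filterI (nb v w cvw) (nb w v cwv)).
    move=> /nbhs_ballP[d /= d0 dP]; exists (d / 2); first by rewrite divr_gt0.
    have small s : 0 <= s <= d / 2 -> ball (0 : R) d s.
      move=> /andP[s0 sd]; rewrite -ball_normE/= sub0r normrN ger0_norm//.
      by rewrite (le_lt_trans sd)// ltr_pdivrMr// ltr_pMr// ltr1n.
    move=> s t s0 t0; have [[u1 u2] [u3 u4]] := dP (s, t) (conj (small s s0) (small t t0)).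
    rewrite addrCA in u2; rewrite addrCA in u4.
    exact: (And4 u1 u3 u2 u4).
  have [s [t [s0 t0 E1]]] : exists s t, [/\ 0 <= s <= d, 0 <= t <= d &
    f (d *: v + (d *: w + x)) - f (d *: w + x) - f (d *: v + x) + f x =
    d * d * 'D_w ('D_v f) (t *: w + (s *: v + x))].
    apply: (second_difference d0) => s t s0 t0; have [u1 _ _ _] := nbd s t s0 t0.
    have [_ u2 _ _] := nbd t s t0 s0.
    have [dv _ _ _] := df _ u1.
    have [_ _ dvw _] := df _ u2.
    exact: (conj dv dvw).
  have [s' [t' [s'0 t'0 E2]]] : exists s t, [/\ 0 <= s <= d, 0 <= t <= d &
    f (d *: w + (d *: v + x)) - f (d *: v + x) - f (d *: w + x) + f x =
    d * d * 'D_v ('D_w f) (t *: v + (s *: w + x))].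
    apply: (second_difference d0) => s' t' s'0 t'0; have [_ u1 _ _] := nbd s' t' s'0 t'0.
    have [u2 _ _ _] := nbd t' s' t'0 s'0.
    have [_ dw _ _] := df _ u1.
    have [_ _ _ dwv] := df _ u2.
    exact: (conj dw dwv).
  have [_ _ n1 _] := nbd s t s0 t0; have [_ _ _ n2] := nbd s' t' s'0 t'0.
  (* [A] and [B] are the same quotient of the second difference, so [X] and [Y] both lie within e/2
     of it. *)
  have squeeze (X Y A B L1 L2 : R) : L1 = L2 -> L1 = d * d * A -> L2 = d * d * B ->
      `|X - A| <= e / 2 -> `|Y - B| <= e / 2 -> `|X - Y| <= e.
    move=> -> -> /(mulfI _) BA XA; rewrite BA ?mulf_neq0 ?gt_eqF// in XA *.
    rewrite distrC => YB; rewrite -(subrKA B) (le_trans (ler_normD _ _))//.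
    by rewrite (splitr e) lerD.
  apply: squeeze E1 E2 n1 n2.
  by rewrite (addrCA (d *: v)) [f _ - _ - f _]addrAC.
move: ('D_w ('D_v f) x) ('D_v ('D_w f) x) key => X Y key.
apply/eqP; rewrite -subr_eq0 -normr_le0; apply/ler_addgt0Pl => e e0.
by rewrite addr0; exact: key.
Unshelve. all: by end_near. Qed.

Lemma derive_comm (V : normedModType R) m n (U : set V) (f : V -> 'M[R]_(m, n))
    (x v w : V) : open U -> Ck 2 U f -> U x ->
  'D_w ('D_v f) x = 'D_v ('D_w f) x.
Proof.
move=> oU Cf Ux.
have nU y : U y -> \forall z \near y, U z by move=> Uy; exact: open_nbhs_nbhs.
have df a y : U y -> derivable f y a by move=> Uy; exact/diff_derivable/Cf.1.
have ddf a b y : U y -> derivable ('D_a f) y b.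
  by move=> Uy; exact/diff_derivable/(Cf.2 a).1.
have D1 a i j y : U y -> 'D_a (fun z => f z i j) y = ('D_a f y) i j.
  by move=> Uy; rewrite (derive_mx (df a y Uy)) mxE.
have nD1 a i j y : U y ->
    \forall z \near y, ('D_a f z) i j = 'D_a (fun z => f z i j) z.
  by move=> Uy; near=> z; rewrite D1//; near: z; exact: nU.
have D2 a b i j y : U y ->
    'D_b ('D_a (fun z => f z i j)) y = ('D_b ('D_a f) y) i j.
  move=> Uy; rewrite -(near_eq_derive _ (nD1 a i j y Uy)).
  by rewrite (derive_mx (ddf a b y Uy)) mxE.
have c2 a b i j : {for x, continuous ('D_b ('D_a (fun z => f z i j)))}.
  have c : {for x, continuous (fun z => ('D_b ('D_a f) z) i j)}.
    apply: (cvg_comp ('D_b ('D_a f)) (fun M : 'M[R]_(m, n) => M i j)).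
      exact: ((Cf.2 a).2 b x Ux).
    exact: coord_continuous.
  rewrite /prop_for /continuous_at D2//; apply: cvg_trans c.
  by apply: near_eq_cvg; near=> z; rewrite D2//; near: z; exact: nU.
have d1 a i j y : U y -> derivable (fun z => f z i j) y a.
  by move=> Uy; exact: (derivable_mxP _ _ _).1 (df a y Uy) i j.
have d2 a b i j y : U y -> derivable ('D_a (fun z => f z i j)) y b.
  move=> Uy; apply: near_eq_derivable (nD1 a i j y Uy) _.
  exact: (derivable_mxP _ _ _).1 (ddf a b y Uy) i j.
apply/matrixP => i j; apply: (etrans (esym (D2 v w i j x Ux))).
apply: (etrans _ (D2 w v i j x Ux)).
apply: (derive_comm_scalar oU Ux _ (c2 v w i j) (c2 w v i j)) => y Uy.
exact: (And4 (d1 v i j y Uy) (d1 w i j y Uy) (d2 v w i j y Uy) (d2 w v i j y Uy)).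
Unshelve. all: by end_near. Qed.

End ClassCk.

(* Otherwise failed unifications unfold the limits defining derivatives. *)
#[local] Opaque derive.

(** * The lowered acceleration in coordinates *)

Section LoweredAcceleration.
Context (R : realType) (n : nat).
Implicit Types (G H : 'M[R]_n) (a b w : 'rV[R]_n).

Definition bil G a b : R := (a *m G *m b^T) 0 0.

Lemma bilDl G a a' b : bil G (a + a') b = bil G a b + bil G a' b.
Proof. by rewrite /bil !mulmxDl mxE. Qed.

Lemma bilDr G a b b' : bil G a (b + b') = bil G a b + bil G a b'.
Proof. by rewrite /bil linearD/= mulmxDr mxE. Qed.

Lemma bilZl G k a b : bil G (k *: a) b = k * bil G a b.
Proof. by rewrite /bil -!scalemxAl mxE. Qed.

Lemma bilZr G k a b : bil G a (k *: b) = k * bil G a b.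
Proof. by rewrite /bil linearZ/= -scalemxAr mxE. Qed.

Lemma bilDm G H a b : bil (G + H) a b = bil G a b + bil H a b.
Proof. by rewrite /bil mulmxDr mulmxDl mxE. Qed.

Lemma bil_tr G a b : bil G^T a b = bil G b a.
Proof. by rewrite /bil -[RHS]trace_mx11 -mxtrace_tr !trmx_mul trmxK mulmxA trace_mx11. Qed.

Lemma bil_sym G a b : G^T = G -> bil G a b = bil G b a.
Proof. by move=> {1}<-; exact: bil_tr. Qed.

Lemma bil_mul m (G : 'M[R]_m) (P Q : 'M[R]_(n, m)) a b :
  bil (P *m G *m Q^T) a b = (a *m P *m G *m (b *m Q)^T) 0 0.
Proof. by rewrite /bil trmx_mul !mulmxA. Qed.

Lemma bil_delta G i j : bil G (delta_mx 0 i) (delta_mx 0 j) = G i j.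
Proof. by rewrite /bil -rowE trmx_delta -colE !mxE. Qed.

(* The covariant acceleration with its index lowered by [G]; no Christoffel
   symbol, hence no inverse matrix, is needed. *)
Definition lowered_acc (G : 'rV[R]_n -> 'M[R]_n) (x : R -> 'rV[R]_n) (t : R) w : R :=
  bil (G (x t)) ('D_1 ('D_1 x) t) w
  + bil ('D_('D_1 x t) G (x t)) ('D_1 x t) w
  - 2^-1 * bil ('D_w G (x t)) ('D_1 x t) ('D_1 x t).

(** Tangent vectors are rows, so they multiply this matrix from the left. Since [Ck] speaks of
    directional derivatives, writing the entries as such lets their regularity be read off
    directly. *)
Definition jac (psi : 'rV[R]_n -> 'rV[R]_n) (z : 'rV[R]_n) : 'M[R]_n :=
  \matrix_(i, j) ('D_(delta_mx 0 i) psi z) 0 j.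

Lemma mul_jac psi z w : differentiable psi z -> w *m jac psi z = 'D_w psi z.
Proof.
move=> dpsi; rewrite deriveEjacobian//; congr (_ *m _); apply/matrixP => i j.
by rewrite mxE deriveEjacobian// -rowE mxE.
Qed.

Lemma differentiable_jac (W : set 'rV[R]_n) psi z : Ck 2 W psi -> W z ->
  differentiable (jac psi) z.
Proof.
move=> Cpsi Wz; apply: differentiable_mx => i j.
under eq_fun do rewrite mxE.
exact: (differentiable_comp ((Cpsi.2 _).1 z Wz) (differentiable_coord _ _ _)).
Qed.

(** Both sides are mixed second derivatives of [psi], in the two orders. *)
Lemma jac_sym (W : set 'rV[R]_n) psi z v w : open W -> Ck 2 W psi -> W z ->
  v *m 'D_w (jac psi) z = w *m 'D_v (jac psi) z.
Proof.
move=> oW Cpsi Wz.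
have nW : \forall y \near z, W y by exact: open_nbhs_nbhs.
have D a b : 'D_b ('D_a psi) z = a *m 'D_b (jac psi) z.
  have dj : is_derive z b (jac psi) ('D_b (jac psi) z).
    by apply/derivableP/diff_derivable/differentiable_jac; eassumption.
  have := is_derive_mulmx (is_derive_cst a z b) dj.
  rewrite mul0mx add0r => -[_ <-]; apply: near_eq_derive.
  by near=> y; rewrite /= mul_jac//; apply: Cpsi.1; near: y.
by rewrite -!D; exact: derive_comm oW Cpsi Wz.
Unshelve. all: by end_near. Qed.

Lemma velocity_change (x : R -> 'rV[R]_n) psi t :
  differentiable x t -> differentiable psi (x t) ->
  'D_1 (psi \o x) t = 'D_1 x t *m jac psi (x t).
Proof.
move=> dx dpsi; apply: etrans (esym (mul_jac _ dpsi)).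
by have [_] := @is_derive_chain R _ _ _ x psi t 1 dx dpsi.
Qed.

(** The linear algebra of a change of coordinates with Jacobian [J]: the left side comes from the
    product rule for J H J^T. Its unwanted term is bil Hy (v J) (w DJv). The last line
    differentiates [J] in the direction [w] in two factors, equal since [Hy] is symmetric; their
    halves add up to that term by the symmetry [v *m DJw = w *m DJv]. *)
Lemma lowered_acc_algebra (J DJv DJw Hy DHv DHw : 'M[R]_n) v w A : Hy^T = Hy ->
  v *m DJw = w *m DJv ->
  bil (J *m Hy *m J^T) A w
  + bil ((DJv *m Hy + J *m DHv) *m J^T + J *m Hy *m DJv^T) v w
  - 2^-1 * bil ((DJw *m Hy + J *m DHw) *m J^T + J *m Hy *m DJw^T) v v =
  bil Hy (A *m J + v *m DJv) (w *m J) + bil DHv (v *m J) (w *m J)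
  - 2^-1 * bil DHw (v *m J) (v *m J).
Proof.
move=> Hsym Jsym.
have E P Q K a b : bil (P *m K *m Q^T) a b = bil K (a *m P) (b *m Q).
  by rewrite bil_mul /bil.
rewrite !mulmxDl !bilDm !bilDl !E Jsym [bil Hy (w *m _) (v *m J)]bil_sym//.
by field.
Qed.

(* Covariance of the Euler-Lagrange expression of the energy; the second
   derivatives of [psi] cancel because they are symmetric ([jac_sym]). *)
Lemma lowered_acc_change (W : set 'rV[R]_n) psi (G H : 'rV[R]_n -> 'M[R]_n)
    (x : R -> 'rV[R]_n) (t : R) w :
  open W -> W (x t) -> Ck 2 W psi ->
  (forall z, W z -> G z = jac psi z *m H (psi z) *m (jac psi z)^T) ->
  (H (psi (x t)))^T = H (psi (x t)) ->
  differentiable H (psi (x t)) ->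
  (\forall u \near t, differentiable x u) -> differentiable ('D_1 x) t ->
  lowered_acc G x t w = lowered_acc H (psi \o x) t (w *m jac psi (x t)).
Proof.
move=> oW Wx Cpsi GH Hsym dH dx ddx.
have dxt : differentiable x t := nbhs_singleton dx.
have nW : \forall y \near x t, W y by exact: open_nbhs_nbhs.
have nWx : \forall u \near t, W (x u) by exact: (differentiable_continuous dxt).
have dpsi : differentiable psi (x t) by exact: Cpsi.1.
have dJ : differentiable (jac psi) (x t) by exact: differentiable_jac Cpsi Wx.
have dHpsi a : is_derive (x t) a (H \o psi) ('D_(a *m jac psi (x t)) H (psi (x t))).
  rewrite (mul_jac a dpsi); exact: (is_derive_chain a dpsi dH).
have DG a : 'D_a G (x t) =
    ('D_a (jac psi) (x t) *m H (psi (x t)) +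
      jac psi (x t) *m 'D_(a *m jac psi (x t)) H (psi (x t))) *m (jac psi (x t))^T +
    jac psi (x t) *m H (psi (x t)) *m ('D_a (jac psi) (x t))^T.
  have dJa : is_derive (x t) a (jac psi) ('D_a (jac psi) (x t)).
    exact/derivableP/diff_derivable.
  have [_ <-] := is_derive_mulmx (is_derive_mulmx dJa (dHpsi a)) (is_derive_trmx dJa).
  by apply: near_eq_derive; near=> z; apply: GH; near: z.
have y1 : 'D_1 (psi \o x) t = 'D_1 x t *m jac psi (x t) by exact: velocity_change.
have y2 : 'D_1 ('D_1 (psi \o x)) t = 'D_1 ('D_1 x) t *m jac psi (x t) +
    'D_1 x t *m 'D_('D_1 x t) (jac psi) (x t).
  have ddx' : is_derive t 1 ('D_1 x) ('D_1 ('D_1 x) t) by exact/derivableP/diff_derivable.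
  have [_ <-] := is_derive_mulmx ddx' (@is_derive_chain R _ _ _ x (jac psi) t 1 dxt dJ).
  apply: near_eq_derive; near=> u => /=; apply: velocity_change.
    by near: u.
  by apply: Cpsi.1; near: u.
rewrite /lowered_acc y2 y1 (DG w) (DG ('D_1 x t)) (GH _ Wx).
apply: (lowered_acc_algebra _ _ _ _ Hsym).
exact: jac_sym oW Cpsi Wx.
Unshelve. all: by end_near. Qed.

Lemma derive_delta (G : 'rV[R]_n -> 'M[R]_n) z w : differentiable G z ->
  'D_w G z = \sum_i w 0 i *: 'D_(delta_mx 0 i) G z.
Proof.
move=> dG; rewrite deriveE// {1}[w]row_sum_delta linear_sum.
by apply: eq_bigr => i _; rewrite linearZ/= deriveE.
Qed.

(** Lowering the index cancels the inverse matrix in the Christoffel symbols. Contracted with [v]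
    twice, their first two terms coincide, which doubles one and leaves the factor 1/2 on the
    other. *)
Lemma bil_christoffel (G : 'rV[R]_n -> 'M[R]_n) (z v w : 'rV[R]_n) :
  differentiable G z -> (G z)^T = G z -> G z \in unitmx ->
  bil (G z) (\row_k \sum_(i < n) \sum_(j < n)
     (2^-1 * \sum_(l < n) invmx (G z) k l *
      ('D_(delta_mx 0 i) (fun y => G y j l) z
       + 'D_(delta_mx 0 j) (fun y => G y i l) z
       - 'D_(delta_mx 0 l) (fun y => G y i j) z)) * v 0 i * v 0 j) w =
  bil ('D_v G z) v w - 2^-1 * bil ('D_w G z) v v.
Proof.
move=> dG Gsym Gunit.
pose dGe (i : 'I_n) : 'M[R]_n := 'D_(delta_mx 0 i) G z.
have dGd i : derivable G z (delta_mx 0 i) by exact: diff_derivable.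
have dGE i j l : 'D_(delta_mx 0 i) (fun y => G y j l) z = dGe i j l.
  by rewrite /dGe (derive_mx (dGd i)) mxE.
have bilE (A : 'M[R]_n) a b : bil A a b = \sum_i \sum_j A i j * a 0 i * b 0 j.
  rewrite /bil mxE exchange_big/=; apply: eq_bigr => j _.
  rewrite !mxE big_distrl/=; apply: eq_bigr => i _; ring.
(* Twice the Christoffel term with its index lowered, contracted with [v] twice. *)
pose beta : 'rV[R]_n := \row_l (2 * (v *m 'D_v G z) 0 l - bil (dGe l) v v).
have -> : (\row_k \sum_(i < n) \sum_(j < n)
     (2^-1 * \sum_(l < n) invmx (G z) k l *
      ('D_(delta_mx 0 i) (fun y => G y j l) z
       + 'D_(delta_mx 0 j) (fun y => G y i l) z
       - 'D_(delta_mx 0 l) (fun y => G y i j) z)) * v 0 i * v 0 j) =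
   2^-1 *: (beta *m (invmx (G z))^T).
  apply/rowP => k; rewrite !mxE.
  transitivity (2^-1 * \sum_i \sum_j \sum_l invmx (G z) k l *
      (dGe i j l + dGe j i l - dGe l i j) * v 0 i * v 0 j).
    rewrite big_distrr/=; apply: eq_bigr => i _; rewrite big_distrr/=; apply: eq_bigr => j _.
    rewrite -!mulrA; congr (_ * _); rewrite big_distrl/=; apply: eq_bigr => l _.
    by rewrite !dGE !mulrA.
  congr (_ * _).
  transitivity (\sum_l invmx (G z) k l * \sum_i \sum_j
      (dGe i j l + dGe j i l - dGe l i j) * v 0 i * v 0 j).
    transitivity (\sum_i \sum_l \sum_j invmx (G z) k l *
      (dGe i j l + dGe j i l - dGe l i j) * v 0 i * v 0 j).
      by apply: eq_bigr => i _; rewrite exchange_big.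
    rewrite exchange_big/=; apply: eq_bigr => l _; rewrite big_distrr/=.
    by apply: eq_bigr => i _; rewrite big_distrr/=; apply: eq_bigr => j _; rewrite !mulrA.
  apply: eq_bigr => l _; rewrite !mxE mulrC; congr (_ * _).
  rewrite bilE.
  transitivity (\sum_i \sum_j dGe i j l * v 0 i * v 0 j +
      \sum_i \sum_j dGe j i l * v 0 i * v 0 j - \sum_i \sum_j dGe l i j * v 0 i * v 0 j).
    rewrite -big_split -sumrB/=; apply: eq_bigr => i _.
    by rewrite -big_split -sumrB/=; apply: eq_bigr => j _; ring.
  congr (_ - _).
  have -> : \sum_i \sum_j dGe j i l * v 0 i * v 0 j = \sum_i \sum_j dGe i j l * v 0 i * v 0 j.
    rewrite exchange_big/=; apply: eq_bigr => i _; apply: eq_bigr => j _; ring.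
  rewrite -mulr2n mulr_natl; congr (_ *+ _).
  rewrite exchange_big/=; apply: eq_bigr => j _.
  rewrite derive_delta// summxE big_distrr/=; apply: eq_bigr => i _.
  by rewrite mxE -/(dGe i); ring.
rewrite bilZl trmx_inv Gsym.
have -> : bil (G z) (beta *m invmx (G z)) w = (beta *m w^T) 0 0.
  by rewrite /bil mulmxKV.
have -> : (beta *m w^T) 0 0 = 2 * bil ('D_v G z) v w - bil ('D_w G z) v v.
  rewrite mxE.
  transitivity (\sum_l (2 * ((v *m 'D_v G z) 0 l * w 0 l) - w 0 l * bil (dGe l) v v)).
    by apply: eq_bigr => l _; rewrite !mxE; ring.
  rewrite sumrB -big_distrr/=; congr (_ - _).
    by congr (_ * _); rewrite /bil mxE; apply: eq_bigr => l _; rewrite [w^T l 0]mxE.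
  rewrite (derive_delta w)// [RHS]/bil mulmx_sumr mulmx_suml summxE.
  by apply: eq_bigr => l _; rewrite -scalemxAr -scalemxAl mxE.
by rewrite mulrBr mulKf ?pnatr_eq0.
Qed.

End LoweredAcceleration.

(** * The metric in charts *)

Section Charts.
Context (R : realType) (n : nat) (Q : riemannianManifold R n).
Implicit Types (c p : Q) (v w : 'rV[R]_n) (z : 'rV[R]_n).

Definition dom c : set Q := chart_dom (chart_at c).

Definition transition c c' : 'rV[R]_n -> 'rV[R]_n := chart_at c' \o chart_inv (chart_at c).

Definition overlap c c' : set 'rV[R]_n := chart_at c @` (dom c `&` dom c').

Lemma open_overlap c c' : open (overlap c c').
Proof.
rewrite openE => _ [p [cp c'p] <-] /=.
have pc : (chart_at c @` dom c) (chart_at c p) by exists p.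
have n1 : \forall z \near chart_at c p, (chart_at c @` dom c) z.
  by apply: open_nbhs_nbhs; split; [exact: chart_codom_open | exact: pc].
have n2 : \forall z \near chart_at c p, dom c' (chart_inv (chart_at c) z).
  apply: (chart_inv_continuous pc); rewrite chart_funK//.
  by apply: open_nbhs_nbhs; split; [exact: chart_dom_open | exact: c'p].
rewrite /interior; apply: filterS2 n1 n2 => z [p' cp' <-]; rewrite chart_funK// => c'p'.
by exists p'.
Qed.

Lemma overlap_self c : overlap c c = chart_at c @` dom c.
Proof. by rewrite /overlap setIid. Qed.

Lemma transition_Ck k c c' : Ck k (overlap c c') (transition c c').
Proof. exact: chart_at_smooth. Qed.

Lemma transitionE c c' p : dom c p -> transition c c' (chart_at c p) = chart_at c' p.
Proof. by move=> cp; rewrite /transition/= chart_funK. Qed.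

Lemma transition_differentiable c c' p : dom c p -> dom c' p ->
  differentiable (transition c c') (chart_at c p).
Proof. by move=> cp c'p; apply: (transition_Ck 1 c c').1; exists p. Qed.

Lemma change_chartE c c' p v : dom c p -> dom c' p ->
  change_chart c c' p v = v *m jac (transition c c') (chart_at c p).
Proof.
by move=> cp c'p; apply/esym/mul_jac/transition_differentiable.
Qed.

Lemma change_chart_comp c c' c'' p v : dom c p -> dom c' p -> dom c'' p ->
  change_chart c' c'' p (change_chart c c' p v) = change_chart c c'' p v.
Proof.
move=> cp c'p c''p; rewrite /change_chart -/(transition _ _) -/(transition _ _).
have dtr := transition_differentiable cp c'p.
have dtr' : differentiable (transition c' c'') (transition c c' (chart_at c p)).
  by rewrite transitionE//; exact: transition_differentiable.
have [_ E] := is_derive_chain v dtr dtr'; rewrite (transitionE c' cp) in E.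
apply: etrans (esym E) _; apply: near_eq_derive.
have n1 : \forall z \near chart_at c p, overlap c c' z.
  by apply: open_nbhs_nbhs; split; [exact: open_overlap | exists p].
by apply: filterS n1 => _ [p' [cp' c'p'] <-]; rewrite /= !transitionE// chart_funK.
Qed.

Lemma change_chart_id c p v : dom c p -> change_chart c c p v = v.
Proof.
move=> cp; rewrite -[RHS](@derive_id _ _ (chart_at c p) v); apply: near_eq_derive.
have n1 : \forall z \near chart_at c p, overlap c c z.
  by apply: open_nbhs_nbhs; split; [exact: open_overlap | exists p].
apply: filterS n1 => _ [p' [cp' _] <-]; by rewrite /= chart_funK.
Qed.

Lemma mem_dom p : dom p p.
Proof. exact: chart_at_dom. Qed.

Let G c : 'rV[R]_n -> 'M[R]_n := gram (@metric R n Q) c.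

Lemma gram_jac c p : dom c p ->
  gram (@metric R n Q) c (chart_at c p) =
  jac (transition c p) (chart_at c p) *m metric p *m (jac (transition c p) (chart_at c p))^T.
Proof.
move=> cp; apply/matrixP => i j; rewrite mxE chart_funK//.
by rewrite !(change_chartE _ cp (mem_dom p)) -bil_mul bil_delta.
Qed.

Lemma bil_gram c p v w : dom c p ->
  bil (G c (chart_at c p)) v w =
  bil (metric p) (change_chart c p p v) (change_chart c p p w).
Proof.
move=> cp; rewrite /G gram_jac// bil_mul !(change_chartE _ cp (mem_dom p)).
by [].
Qed.

Lemma gram_center p : G p (chart_at p p) = metric p.
Proof.
apply/matrixP => i j.
rewrite -(bil_delta (G _ _)) (bil_gram _ _ (mem_dom p)).
by rewrite !(change_chart_id _ (mem_dom p)) bil_delta.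
Qed.

Lemma gram_sym c z : (G c z)^T = G c z.
Proof.
apply/matrixP => i j; rewrite [LHS]mxE [LHS]mxE [RHS]mxE.
by apply: bil_sym; exact: Defs.metric_sym.
Qed.

Lemma gram_pos c p v : dom c p -> v != 0 -> 0 < bil (G c (chart_at c p)) v v.
Proof.
move=> cp v0; rewrite bil_gram//; apply: metric_pos; apply: contra v0 => /eqP v0.
have := change_chart_comp v cp (mem_dom p) cp.
by rewrite v0 (change_chart_id _ cp) (change_chartE _ (mem_dom p) cp) mul0mx => <-.
Qed.

Lemma gram_unit c p : dom c p -> G c (chart_at c p) \in unitmx.
Proof.
move=> cp; rewrite -row_free_unit; apply: inj_row_free => v vG.
apply/eqP/negPn/negP => /(gram_pos cp).
by rewrite /bil vG mul0mx mxE ltxx.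
Qed.

Lemma gram_Ck k c : Ck k (overlap c c) (G c).
Proof. by rewrite overlap_self; exact: metric_smooth. Qed.

Lemma gram_differentiable c p : dom c p -> differentiable (G c) (chart_at c p).
Proof. by move=> cp; apply: (gram_Ck 1 c).1; exists p. Qed.

Lemma gram_pullback c c' z : overlap c c' z ->
  G c z = jac (transition c c') z *m G c' (transition c c' z) *m
    (jac (transition c c') z)^T.
Proof.
move=> [p [cp c'p] <-]; rewrite transitionE//.
apply/matrixP => i j.
rewrite -(bil_delta (G _ _)) -(bil_delta (_ *m _)) bil_mul -/(bil _ _ _).
rewrite -!(change_chartE _ cp c'p) (bil_gram _ _ c'p) (bil_gram _ _ cp).
by rewrite !(change_chart_comp _ cp c'p (mem_dom p)).
Qed.

Lemma tnorm_bil p (v : tangent p) : tnorm v = Num.sqrt (bil (metric p) v v).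
Proof. by []. Qed.

Lemma metric_ge0 p v : 0 <= bil (metric p) v v.
Proof.
have [->|v0] := eqVneq v 0; first by rewrite /bil !mul0mx mxE.
exact/ltW/metric_pos.
Qed.

Lemma sqr_tnorm p (v : tangent p) : tnorm v ^+ 2 = bil (metric p) v v.
Proof. by rewrite tnorm_bil sqr_sqrtr// metric_ge0. Qed.

Lemma tnorm_ge0 p (v : tangent p) : 0 <= tnorm v.
Proof. exact: sqrtr_ge0. Qed.

Lemma tnormZ p k (v : 'rV[R]_n) :
  tnorm ((k *: v : 'rV[R]_n) : tangent p) = `|k| * tnorm (v : tangent p).
Proof.
by rewrite !tnorm_bil bilZl bilZr mulrA -expr2 sqrtrM ?sqr_ge0// sqrtr_sqr.
Qed.

Lemma cauchy_schwarz p (v w : tangent p) :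
  `|bil (metric p) v w| <= tnorm v * tnorm w.
Proof.
rewrite -(ler_pXn2r (ltn0Sn 1)) ?nnegrE ?normr_ge0 ?mulr_ge0 ?tnorm_ge0//.
rewrite real_normK ?num_real// exprMn !sqr_tnorm.
set A := bil _ v v; set B := bil _ w w; set C := bil _ v w.
have CE : bil (metric p) w v = C by apply: bil_sym; exact: Defs.metric_sym.
have q (s t : R) : 0 <= s ^+ 2 * A + 2 * s * t * C + t ^+ 2 * B.
  have := metric_ge0 p (s *: (v : 'rV[R]_n) + t *: (w : 'rV[R]_n)).
  by rewrite bilDl !bilDr !bilZl !bilZr CE -/A -/B -/C; congr (0 <= _); ring.
have [B0|B0] := eqVneq B 0.
  have [->|C0] := eqVneq C 0; first by rewrite expr0n/= B0 mulr0 lexx.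
  (* At this point the form would take the negative value - A - 2. *)
  have := q 1 (- (A + 1) / C); rewrite B0.
  have -> : 1 ^+ 2 * A + 2 * 1 * (- (A + 1) / C) * C + (- (A + 1) / C) ^+ 2 * 0 = - A - 2.
    by field.
  by have := metric_ge0 p v; rewrite -/A => A0 h; lra.
(* The minimizing direction, scaled by [B] to avoid a division. *)
have := q B (- C); have Bpos : 0 < B by rewrite lt_neqAle eq_sym B0 metric_ge0.
have -> : B ^+ 2 * A + 2 * B * - C * C + (- C) ^+ 2 * B = B * (A * B - C ^+ 2) by ring.
by rewrite pmulr_rge0// subr_ge0.
Qed.

End Charts.

(** * Velocity and acceleration read in a fixed chart *)

Section CurvesInCharts.
Context (R : realType) (n : nat) (Q : riemannianManifold R n).
Implicit Types (c : Q) (a b t : R) (q : R -> Q) (x : R -> 'rV[R]_n).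

(** The chart is centred at a fixed [c] instead of the moving point [q u], so quantities at
    different times can be compared. As [x] is constrained only on [[a, b]], it may be a smooth
    extension with two-sided derivatives at the endpoints. *)
Definition chart_reads c a b q x t : Prop := \forall u \near t, u \in `[a, b] ->
  dom c (q u) /\ chart_at c (q u) = x u.

Lemma chart_reads_near c a b q x t : chart_reads c a b q x t ->
  \forall u \near t, chart_reads c a b q x u.
Proof. exact: nbhs_interior. Qed.

Lemma chart_reads_at c a b q x t : t \in `[a, b] -> chart_reads c a b q x t ->
  dom c (q t) /\ chart_at c (q t) = x t.
Proof. by move=> tab /nbhs_singleton; exact. Qed.

Lemma velocity_read c a b q x t : a < b -> t \in `[a, b] ->
  chart_reads c a b q x t -> differentiable x t ->
  velocity a b q t = change_chart c (q t) (q t) ('D_1 x t).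
Proof.
move=> ab tab rd dx; have [cq xE] := chart_reads_at tab rd.
have dtr : differentiable (transition c (q t)) (x t).
  by rewrite -xE; exact: transition_differentiable (mem_dom _).
have dch := @is_derive_chain R _ _ _ x (transition c (q t)) t 1 dx dtr.
rewrite /velocity (@deriv_onE _ _ _ _ _ _ (transition c (q t) \o x))//.
- by rewrite (@derive_val _ _ _ _ _ _ _ dch) /change_chart xE.
- by apply: filterS rd => u rdu uab; have [cu xu] := rdu uab; rewrite /= -xu transitionE.
Qed.

Lemma sqr_tnorm_velocity c a b q x t : a < b -> t \in `[a, b] ->
  chart_reads c a b q x t -> differentiable x t ->
  tnorm (velocity a b q t) ^+ 2 =
  bil (gram (@metric R n Q) c (x t)) ('D_1 x t) ('D_1 x t).
Proof.
move=> ab tab rd dx; have [cq xE] := chart_reads_at tab rd.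
by rewrite sqr_tnorm (velocity_read ab tab rd dx) -xE bil_gram.
Qed.

Lemma acceleration_read_center a b q x t : a < b -> t \in `[a, b] ->
  chart_reads (q t) a b q x t -> (\forall u \near t, differentiable x u) ->
  derivable ('D_1 x) t 1 ->
  acceleration a b q t = 'D_1 ('D_1 x) t + \row_k \sum_(i < n) \sum_(j < n)
    christoffel (q t) (x t) k i j * 'D_1 x t 0 i * 'D_1 x t 0 j.
Proof.
move=> ab tab rd dx ddx; have [cq xE] := chart_reads_at tab rd.
have dxt : differentiable x t := nbhs_singleton dx.
have dx1 : derivable x t 1 by exact: diff_derivable.
have Dx : deriv_on a b (fun u => chart_at (q t) (q u)) t = 'D_1 x t.
  apply: (@deriv_onE _ _ _ _ _ _ x ab tab _ dx1).
  by apply: filterS rd => u rdu uab; have [] := rdu uab.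
(* The velocity at [u] is carried from the chart at [q t] to the one at [q u] and back, so the two
   changes cancel. *)
have xiE : \forall u \near t, u \in `[a, b] ->
    change_chart (q u) (q t) (q u) (velocity a b q u) = 'D_1 x u.
  apply: filterS2 (chart_reads_near rd) dx => u rdu dxu uab.
  have [cu _] := chart_reads_at uab rdu.
  rewrite (velocity_read ab uab rdu dxu).
  by rewrite (change_chart_comp _ cu (mem_dom _) cu) (change_chart_id _ cu).
have Dxi : deriv_on a b
    (fun u => change_chart (q u) (q t) (q u) (velocity a b q u)) t = 'D_1 ('D_1 x) t.
  exact: (deriv_onE ab tab xiE ddx).
apply/rowP => k; rewrite /acceleration /cov_deriv !mxE Dxi Dx (nbhs_singleton xiE tab) xE.
by [].
Qed.

Lemma acceleration_lowered_center a b q x t w : a < b -> t \in `[a, b] ->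
  chart_reads (q t) a b q x t -> (\forall u \near t, differentiable x u) ->
  derivable ('D_1 x) t 1 ->
  bil (metric (q t)) (acceleration a b q t) w =
  lowered_acc (gram (@metric R n Q) (q t)) x t w.
Proof.
move=> ab tab rd dx ddx; have [cq xE] := chart_reads_at tab rd.
rewrite (acceleration_read_center ab tab rd dx ddx) bilDl -gram_center xE.
rewrite /lowered_acc -addrA; congr (_ + _).
rewrite -(bil_christoffel _ w); first by [].
- by rewrite -xE; exact: gram_differentiable.
- exact: gram_sym.
- by rewrite -xE; exact: gram_unit.
Qed.

(** The acceleration is defined in the chart at [q t], where the Christoffel formula applies;
    covariance of the lowered form transports the identity to the arbitrary chart at [c]. *)
Lemma acceleration_lowered c a b q x t w : a < b -> t \in `[a, b] ->
  chart_reads c a b q x t -> (\forall u \near t, differentiable x u) ->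
  derivable ('D_1 x) t 1 ->
  bil (metric (q t)) (acceleration a b q t) (change_chart c (q t) (q t) w) =
  lowered_acc (gram (@metric R n Q) c) x t w.
Proof.
move=> ab tab rd dx ddx; have [cq xE] := chart_reads_at tab rd.
have dxt : differentiable x t := nbhs_singleton dx.
have ovx : overlap c (q t) (x t).
  by rewrite -xE; exists (q t) => //; split => //; exact: mem_dom.
have oov := @open_overlap _ _ _ c (q t).
have nov : \forall u \near t, overlap c (q t) (x u).
  by apply: (differentiable_continuous dxt); exact: open_nbhs_nbhs.
have Cpsi := transition_Ck 2 c (q t).
(* The same curve read in the chart at [q t]. *)
pose y := transition c (q t) \o x.
have y1 : \forall u \near t, 'D_1 x u *m jac (transition c (q t)) (x u) = 'D_1 y u.
  apply: filterS2 nov dx => u ovu dxu; apply/esym/velocity_change => //.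
  exact: (transition_Ck 1 c (q t)).1.
have dy : \forall u \near t, differentiable y u.
  apply: filterS2 nov dx => u ovu dxu; apply: differentiable_comp => //.
  exact: (transition_Ck 1 c (q t)).1.
have ddy : derivable ('D_1 y) t 1.
  apply: near_eq_derivable y1 _.
  have dJ := differentiable_jac Cpsi ovx.
  have dJx := @is_derive_chain R _ _ _ x (jac (transition c (q t))) t 1 dxt dJ.
  by have [] := is_derive_mulmx (derivableP ddx) dJx.
have rdy : chart_reads (q t) a b q y t.
  apply: filterS2 nov rd => u [p [cp qp] pE] rdu uab; have [cu xu] := rdu uab.
  have pq : p = q u by rewrite -(chart_funK cp) pE -xu chart_funK.
  by rewrite -pq /y/= -pE transitionE.
rewrite (acceleration_lowered_center _ ab tab rdy dy ddy).
rewrite (change_chartE _ cq (mem_dom _)) xE.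
apply/esym/(lowered_acc_change _ oov ovx Cpsi) => //.
- by move=> z; exact: gram_pullback.
- exact: gram_sym.
- by rewrite -xE transitionE//; exact: gram_differentiable (mem_dom _).
- exact: (derivable1_diffP _ _).1 ddx.
Qed.

Definition acc_covector c x t : 'rV[R]_n :=
  \row_j lowered_acc (gram (@metric R n Q) c) x t (delta_mx 0 j).

(** If [om] denotes the components of the acceleration in the chart at [c], the covector is
    [om *m G], and raising its index again returns [om]. The right side refers to one chart only, so
    its continuity in time can be proved. *)
Lemma sqr_tnorm_acceleration c a b q x t : a < b -> t \in `[a, b] ->
  chart_reads c a b q x t -> (\forall u \near t, differentiable x u) ->
  derivable ('D_1 x) t 1 ->
  tnorm (acceleration a b q t) ^+ 2 =
  bil (invmx (gram (@metric R n Q) c (x t))) (acc_covector c x t) (acc_covector c x t).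
Proof.
move=> ab tab rd dx ddx; have [cq xE] := chart_reads_at tab rd.
set G := gram _ c; set A := acceleration a b q t; set al := acc_covector c x t.
pose om := change_chart (q t) c (q t) A.
have omE : change_chart c (q t) (q t) om = A.
  rewrite /om (change_chart_comp _ (mem_dom _) cq (mem_dom _)).
  by rewrite (change_chart_id _ (mem_dom _)).
have Gu : G (x t) \in unitmx by rewrite -xE; exact: gram_unit.
have omG : om *m G (x t) = al.
  apply/rowP => j; rewrite [RHS]mxE -(acceleration_lowered _ ab tab rd dx ddx) -/A -omE.
  rewrite -bil_gram// xE -/G /bil trmx_delta -mulmxA mulmxA -colE [RHS]mxE.
  by [].
rewrite sqr_tnorm -/A -[in LHS]omE -bil_gram// xE -/G.
rewrite /bil -omG mulmxK// trmx_mul mulmxA gram_sym.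
by [].
Qed.

Definition energy c x t : R :=
  bil (gram (@metric R n Q) c (x t)) ('D_1 x t) ('D_1 x t).

(** Compatibility of the connection with the metric: for [w] equal to the velocity, the two metric
    derivatives in [lowered_acc] combine to one half of D_vG(v, v). *)
Lemma is_derive_energy c x t : overlap c c (x t) -> differentiable x t ->
  derivable ('D_1 x) t 1 ->
  is_derive t 1 (energy c x)
    (2 * lowered_acc (gram (@metric R n Q) c) x t ('D_1 x t)).
Proof.
move=> ovx dx ddx; set G := gram _ c.
have dG : differentiable G (x t) by exact: (gram_Ck 1 c).1.
have dGx := @is_derive_chain R _ _ _ x G t 1 dx dG.
have d1 := is_derive_mulmx (is_derive_mulmx (derivableP ddx) dGx)
  (is_derive_trmx (derivableP ddx)).
have d2 := is_derive_coord 0 0 d1.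
apply: is_derive_eq d2 _.
have E (v A : 'rV[R]_n) (K DK : 'M[R]_n) : K^T = K ->
    ((A *m K + v *m DK) *m v^T + v *m K *m A^T) 0 0 =
    2 * (bil K A v + bil DK v v - 2^-1 * bil DK v v).
  by move=> Ksym; rewrite mulmxDl mxE [X in X + _]mxE -!/(bil _ _ _) (bil_sym v A Ksym); field.
exact: E (gram_sym _ _).
Qed.

End CurvesInCharts.

(** * Compactness and the fundamental theorem of calculus *)

Section RealLine.
Context (R : realType).
Notation mu := (@lebesgue_measure R).

(** Compactness of the segment. The predicate [P] admits local bounds around an endpoint that hold
    only at interior points. *)
Lemma locally_bounded_segment (a b : R) (P : set R) (f : R -> R) :
  (forall t, t \in `[a, b] -> exists M, \forall u \near t, P u -> f u <= M) ->
  exists M, forall u, u \in `[a, b] -> P u -> f u <= M.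
Proof.
move=> fbd.
have /compact_near_coveringP cov := @segment_compact R a b.
have [M [_ fM]] : \forall M \near +oo, `[a, b] `<=` [set u | P u -> f u <= M].
  apply: (cov _ _ (fun M u => P u -> f u <= M)) => t /fbd[M Mt].
  exists ([set u | P u -> f u <= M], [set M' | M <= M']).
    by split => //=; exists M; split => [|M' /ltW]//; exact: num_real.
  by move=> [u M'] /= [uM MM'] /uM /le_trans; exact.
exists (M + 1) => u uab Pu; apply: (fM (M + 1)) => //.
by rewrite ltrDl.
Qed.

Lemma within_continuous_local (a b : R) (f : R -> R) :
  (forall t, t \in `[a, b] -> exists y : R -> R,
    {for t, continuous y} /\ \forall u \near t, u \in `[a, b] -> f u = y u) ->
  {within `[a, b], continuous f}.
Proof.
move=> floc; apply/subspace_continuousP => t tab.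
have [y [cy fy]] := floc t tab.
have ft : f t = y t by exact: (nbhs_singleton fy).
have fcv : f @ within `[a, b]%classic (nbhs t) --> y t.
  apply: cvg_trans (cvg_within_filter `[a, b]%classic cy).
  by apply: near_eq_cvg; apply: filterS fy => u fyu /fyu.
by rewrite -ft in fcv.
Qed.

(** The fundamental theorem is applied to the continuous function [deriv_on a b g]; only afterwards
    is it compared with [h], about whose measurability nothing is assumed. *)
Lemma FTC_le (a b : R) (g h : R -> R) : a < b ->
  (forall t, t \in `[a, b] -> exists y : R -> R,
    [/\ \forall u \near t, derivable y u 1, {for t, continuous ('D_1 y)} &
       \forall u \near t, u \in `[a, b] -> g u = y u]) ->
  (forall t, t \in `]a, b[ -> 'D_1 g t <= h t) ->
  (forall t, t \in `[a, b] -> 0 <= h t) ->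
  ((g b - g a)%:E <= \int[mu]_(t in `[a, b]) (h t)%:E)%E.
Proof.
move=> ab gloc gh h0.
have fE (t : R) (y : R -> R) : (\forall u \near t, derivable y u 1) ->
    (\forall u \near t, u \in `[a, b] -> g u = y u) ->
    \forall u \near t, u \in `[a, b] -> deriv_on a b g u = 'D_1 y u.
  move=> dy gy; apply: filterS2 dy (nbhs_interior gy) => u dyu gyu uab.
  exact: (deriv_onE ab uab gyu dyu).
have cf : {within `[a, b], continuous (deriv_on a b g)}.
  apply: within_continuous_local => t tab; have [y [dy cy gy]] := gloc t tab.
  by exists ('D_1 y); split => //; exact: fE.
have cg : {within `[a, b], continuous g}.
  apply: within_continuous_local => t tab; have [y [dy cy gy]] := gloc t tab.
  exists y; split => //; apply: differentiable_continuous.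
  by apply/derivable1_diffP; exact: nbhs_singleton dy.
have dg t : t \in `]a, b[ -> is_derive t 1 g (deriv_on a b g t).
  move=> toab; have tab : t \in `[a, b] by apply: subset_itv_oo_cc.
  have [y [dy _ gy]] := gloc t tab.
  rewrite (nbhs_singleton (fE t y dy gy) tab).
  apply: (@near_eq_is_derive _ _ _ y); last exact/derivableP/(nbhs_singleton dy).
  have nab : \forall u \near t, u \in `[a, b].
    have : \forall u \near t, u \in `]a, b[.
      by apply: open_nbhs_nbhs; split => //; exact: interval_open.
    by apply: filterS => u; exact: subset_itv_oo_cc.
  by apply: filterS2 nab gy => u uab /(_ uab).
have dgLR : derivable_oo_LRcontinuous g a b.
  have [_ ga gb] := (continuous_within_itvP g ab).1 cg.
  by split => // t /dg[].
rewrite EFinB -(continuous_FTC2 ab cf dgLR); last first.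
  by move=> t tab; rewrite derive1E; have [] := dg t tab.
set f := fun t => (deriv_on a b g t)%:E.
(* Monotonicity of the lower integral requires a nonnegative smaller function. Passing to the
   positive part keeps the bound, because [h] is nonnegative. *)
apply: (@le_trans _ _ (\int[mu]_(t in `[a, b]) (f^\+%E t))%E).
  rewrite integralE -[leRHS]sube0; apply: leeB => //.
  by apply: integral_ge0 => t _; exact: funeneg_ge0.
rewrite !(ge0_integral_itv_oo_cc (ltW ab)) =>[|t /h0|t _]; last 2 first.
- by rewrite lee_fin.
- exact: funepos_ge0.
apply: ge0_le_integral_lower => t /= tab; first exact: funepos_ge0.
have h0t : 0 <= h t by apply: h0; apply: subset_itv_oo_cc.
rewrite funeposE ge_max !lee_fin h0t andbT.
by have [_ <-] := dg t tab; exact: gh.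
Qed.

(** [FTC_le] for [g u - k * u]. The constant is thus kept outside the lower integral, where no
    additivity in the integrand is required. *)
Lemma FTC_le_drift (k a b : R) (g h : R -> R) : a < b ->
  (forall t, t \in `[a, b] -> exists y : R -> R,
    [/\ \forall u \near t, derivable y u 1, {for t, continuous ('D_1 y)} &
       \forall u \near t, u \in `[a, b] -> g u = y u]) ->
  (forall t, t \in `]a, b[ -> 'D_1 g t <= k + h t) ->
  (forall t, t \in `[a, b] -> 0 <= h t) ->
  ((g b - g a - k * (b - a))%:E <= \int[mu]_(t in `[a, b]) (h t)%:E)%E.
Proof.
move=> ab gloc gh h0.
have -> : g b - g a - k * (b - a) = g b - k * b - (g a - k * a) by ring.
have dk (y : R -> R) (u : R) : derivable y u 1 ->
    is_derive u 1 (fun u => y u - k * u) ('D_1 y u - k).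
  move=> dy; have -> : k = k *: (1 : R) by rewrite [RHS]mulr1.
  apply: is_deriveB; first exact: derivableP.
  by have := is_deriveZ (k *: (1 : R)) (is_derive_id u (1 : R)); rewrite /GRing.scale/= !mulr1.
apply: (@FTC_le a b (fun u => g u - k * u) h ab) => // t tab.
  have [y [dy cy gy]] := gloc t tab; exists (fun u => y u - k * u); split.
  - by apply: filterS dy => u /dk[].
  - have [_ E] := dk y t (nbhs_singleton dy); rewrite /prop_for /continuous_at E.
    apply: (@cvg_trans _ ((fun u => 'D_1 y u - k) @ t)); last first.
      have cy' : 'D_1 y @ t --> 'D_1 y t := cy.
      have ck : (fun=> k) @ t --> k by exact: cvg_cst.
      exact: (cvgB cy' ck).
    by apply: near_eq_cvg; apply: filterS dy => u /dk[_ ->].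
  - by apply: filterS gy => u gyu /gyu ->.
have dg : derivable g t 1.
  have [y [dy _ gy]] := gloc t (subset_itv_oo_cc tab).
  apply: (@near_eq_derivable _ _ _ y); last exact: nbhs_singleton dy.
  have nab : \forall u \near t, u \in `[a, b].
    have : \forall u \near t, u \in `]a, b[.
      by apply: open_nbhs_nbhs; split => //; exact: interval_open.
    by apply: filterS => u; exact: subset_itv_oo_cc.
  by apply: filterS2 nab gy => u uab /(_ uab).
have [_ ->] := dk g t dg.
by rewrite lerBlDl; exact: gh.
Qed.

(** Peels off the first cell of the partition. It carries estimates from the regular pieces of a
    curve to the whole interval. *)
Lemma itv_partition_ind (P : R -> R -> Prop) (a b : R) (s : seq R) :
  (forall x, P x x) ->
  (forall x y z, a <= x <= y -> y <= z <= b -> P x y -> P y z -> P x z) ->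
  itv_partition a b s ->
  (forall i, (i < size s)%N -> P (nth b (a :: s) i) (nth b s i)) -> P a b.
Proof.
move=> P0; elim: s a => [|c s ih] a PD /=.
  by move=> /itv_partition_nil ->.
move=> abs Ps; have cbs := itv_partition_cons abs.
have ac : a <= c by case: abs => /= /andP[/ltW].
have cb : c <= b := itv_partition_le cbs.
apply: (PD _ c); rewrite ?lexx ?ac ?cb//.
  exact: (Ps 0).
apply: ih cbs _ => [x y z /andP[cx xy]|i si].
  by apply: PD; rewrite (le_trans ac).
exact: (Ps i.+1).
Qed.

End RealLine.

(** * Continuity of metric quantities along curves *)

Section Bounds.
Context (R : realType) (n : nat) (Q : riemannianManifold R n).
Implicit Types (c : Q) (a b t : R) (q : R -> Q) (x : R -> 'rV[R]_n).

Let G c : 'rV[R]_n -> 'M[R]_n := gram (@metric R n Q) c.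

Lemma cvg_bil (F : set_system R) {FF : Filter F} (f : R -> 'M[R]_n)
    (g h : R -> 'rV[R]_n) (A : 'M[R]_n) (v w : 'rV[R]_n) :
  f @ F --> A -> g @ F --> v -> h @ F --> w ->
  (fun u => bil (f u) (g u) (h u)) @ F --> bil A v w.
Proof.
move=> fA gv hw.
have H : (fun u => g u *m f u *m (h u)^T) @ F --> v *m A *m w^T.
  exact: cvg_mulmx (cvg_mulmx gv fA) (cvg_trmx hw).
by move/cvg_mxP : H; exact.
Qed.

Lemma near_overlap c x t : {for t, continuous x} -> overlap c c (x t) ->
  \forall u \near t, overlap c c (x u).
Proof. by move=> cx ov; apply: cx; apply: open_nbhs_nbhs; split => //; exact: open_overlap. Qed.

(** [Ck] gives continuity of derivatives in fixed directions only; a moving direction [w u] is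
    expanded along the basis. *)
Lemma cvg_derive_gram c x (w : R -> 'rV[R]_n) t : {for t, continuous x} ->
  {for t, continuous w} -> overlap c c (x t) ->
  (fun u => 'D_(w u) (G c) (x u)) @ t --> 'D_(w t) (G c) (x t).
Proof.
move=> cx cw ov.
have dG z : overlap c c z -> differentiable (G c) z by exact: (gram_Ck 1 c).1.
rewrite (derive_delta _ (dG _ ov)).
apply: (@cvg_trans _ ((fun u => \sum_i w u 0 i *: 'D_(delta_mx 0 i) (G c) (x u)) @ t)).
  apply: near_eq_cvg; apply: filterS (near_overlap cx ov) => u ovu.
  by rewrite (derive_delta _ (dG _ ovu)).
have ci (i : 'I_n) : (fun u => w u 0 i *: 'D_(delta_mx 0 i) (G c) (x u)) @ t -->
    w t 0 i *: 'D_(delta_mx 0 i) (G c) (x t).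
  have c1 : (fun u => w u 0 i) @ t --> w t 0 i by move/cvg_mxP : cw; exact.
  have c2 : (fun u => 'D_(delta_mx 0 i) (G c) (x u)) @ t --> 'D_(delta_mx 0 i) (G c) (x t).
    apply: (cvg_comp x ('D_(delta_mx 0 i) (G c)) cx).
    exact: ((gram_Ck 1 c).2 (delta_mx 0 i) (x t) ov).
  exact: cvgZ c1 c2.
exact: (cvg_sum (fun i _ => ci i)).
Qed.

Lemma cvg_lowered_acc c (U : set R) x (w : R -> 'rV[R]_n) t : U t -> Ck 2 U x ->
  overlap c c (x t) -> {for t, continuous w} ->
  (fun u => lowered_acc (G c) x u (w u)) @ t --> lowered_acc (G c) x t (w t).
Proof.
move=> Ut Cx ov cw.
have cx : {for t, continuous x} by exact: differentiable_continuous (Cx.1 t Ut).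
have cdx : {for t, continuous ('D_1 x)}.
  exact: differentiable_continuous ((Cx.2 1).1 t Ut).
have cddx : {for t, continuous ('D_1 ('D_1 x))} by exact: ((Cx.2 1).2 1 t Ut).
have cG : (fun u => G c (x u)) @ t --> G c (x t).
  apply: (cvg_comp x (G c) cx); exact: differentiable_continuous ((gram_Ck 1 c).1 _ ov).
have c1 := cvg_bil (FF := nbhs_filter t) cG cddx cw.
have c2 := cvg_bil (FF := nbhs_filter t) (cvg_derive_gram cx cdx ov) cdx cw.
have c3 := cvg_bil (FF := nbhs_filter t) (cvg_derive_gram cx cw ov) cdx cdx.
have c4 : (fun u => 2^-1 * bil ('D_(w u) (G c) (x u)) ('D_1 x u) ('D_1 x u)) @ t -->
    2^-1 * bil ('D_(w t) (G c) (x t)) ('D_1 x t) ('D_1 x t).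
  by apply: cvgM; [exact: cvg_cst | exact: c3].
by rewrite /lowered_acc; exact: (cvgB (cvgD c1 c2) c4).
Qed.

Lemma cvg_sqr_acceleration c (U : set R) x t : U t -> Ck 2 U x -> overlap c c (x t) ->
  (fun u => bil (invmx (G c (x u))) (acc_covector c x u) (acc_covector c x u)) @ t -->
  bil (invmx (G c (x t))) (acc_covector c x t) (acc_covector c x t).
Proof.
move=> Ut Cx ov.
have cx : {for t, continuous x} by exact: differentiable_continuous (Cx.1 t Ut).
have cG : (fun u => G c (x u)) @ t --> G c (x t).
  apply: (cvg_comp x (G c) cx); exact: differentiable_continuous ((gram_Ck 1 c).1 _ ov).
have Gu z : overlap c c z -> G c z \in unitmx by move=> [p [cp _] <-]; exact: gram_unit.
have cal : acc_covector c x @ t --> acc_covector c x t.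
  apply/cvg_mxP => i j; rewrite mxE; under eq_fun do rewrite mxE.
  exact: cvg_lowered_acc Ut Cx ov (cvg_cst _).
have Gun : \forall u \near t, G c (x u) \in unitmx.
  by apply: filterS (near_overlap cx ov) => u; exact: Gu.
by apply: (cvg_bil _ cal cal); exact: (cvg_invmx Gun (Gu _ ov) cG).
Qed.

Lemma cvg_energy c (U : set R) x t : U t -> Ck 1 U x -> overlap c c (x t) ->
  energy c x @ t --> energy c x t.
Proof.
move=> Ut Cx ov.
have cx : {for t, continuous x} by exact: differentiable_continuous (Cx.1 t Ut).
have cG : (fun u => G c (x u)) @ t --> G c (x t).
  apply: (cvg_comp x (G c) cx); exact: differentiable_continuous ((gram_Ck 1 c).1 _ ov).
have cdx : {for t, continuous ('D_1 x)} by exact: ((Cx.2 1) t Ut).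
exact: (cvg_bil cG cdx cdx).
Qed.

Lemma regular_reads reg a b q t : regular_curve reg a b q -> t \in `[a, b] ->
  exists (U : set R) x, [/\ open U, U t, reg U x, overlap (q t) (q t) (x t) &
    forall u, U u -> chart_reads (q t) a b q x u].
Proof.
move=> qreg tab; have [U [x [oU Ut rx qx]]] := qreg t tab; exists U, x; split => //.
  by have [qt <-] := qx t Ut tab; exists (q t).
move=> u Uu; have : \forall v \near u, U v by exact: open_nbhs_nbhs.
by apply: filterS => v Uv vab; exact: qx.
Qed.

Lemma near_itv_oo a b t : t \in `]a, b[ -> \forall u \near t, u \in `[a, b].
Proof.
move=> tab; have : \forall u \near t, u \in `]a, b[.
  by apply: open_nbhs_nbhs; split => //; exact: interval_open.
by apply: filterS => u; exact: subset_itv_oo_cc.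
Qed.

Lemma chart_reads_interior c a b a' b' q x t : t \in `]a', b'[ ->
  chart_reads c a' b' q x t -> chart_reads c a b q x t.
Proof. by move=> /near_itv_oo nt; apply: filterS2 nt => u uab /(_ uab). Qed.

(** Also valid at the ends of the subinterval: a C^1 reading on [[a, b]] has equal one-sided
    derivatives there. This makes the speed agree across breakpoints. *)
Lemma velocity_sub a b a' b' q t : a <= a' -> a' < b' -> b' <= b -> t \in `[a', b'] ->
  C1_curve a b q -> velocity a b q t = velocity a' b' q t.
Proof.
move=> aa' ab' bb' tab' Cq; have ab : a < b by rewrite (le_lt_trans aa')// (lt_le_trans ab').
have sub u : u \in `[a', b'] -> u \in `[a, b].
  by rewrite !in_itv/= => /andP[a'u ub']; rewrite (le_trans aa')// (le_trans ub').
have [U [x [oU Ut Cx ov rd]]] := regular_reads Cq (sub _ tab').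
have rd' : chart_reads (q t) a' b' q x t.
  by apply: filterS (rd t Ut) => u rdu /sub; exact: rdu.
have dx : differentiable x t by exact: Cx.1.
by rewrite (velocity_read ab (sub _ tab') (rd t Ut) dx) (velocity_read ab' tab' rd' dx).
Qed.

End Bounds.

(** * Bounds on speed and acceleration *)

Section SpeedBounds.
Context (R : realType) (n : nat) (Q : riemannianManifold R n).
Implicit Types (c : Q) (a b t : R) (q : R -> Q) (x : R -> 'rV[R]_n).
Notation mu := (@lebesgue_measure R).

Lemma cvg_le_near (F : set_system R) {FF : Filter F} (f : R -> R) (l : R) :
  f @ F --> l -> \forall u \near F, f u <= l + 1.
Proof.
move=> /cvgrPdist_le /(_ 1 ltr01); apply: filterS => u.
by rewrite distrC => /ler_normlP[_]; rewrite lerBlDl addrC.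
Qed.

Lemma le_sqr_bound (M s : R) : 0 <= s -> s ^+ 2 <= M -> s <= M + 1.
Proof. by move=> s0 sM; nra. Qed.

Lemma velocity_bounded a b q : a < b -> C1_curve a b q ->
  exists M, forall t, t \in `[a, b] -> tnorm (velocity a b q t) <= M.
Proof.
move=> ab Cq.
have [M HM] : exists M, forall t, t \in `[a, b] -> [set` `[a, b]] t ->
    tnorm (velocity a b q t) ^+ 2 <= M.
  apply: locally_bounded_segment => t tab.
  have [U [x [oU Ut Cx ov rd]]] := regular_reads Cq tab.
  exists (energy (q t) x t + 1).
  have nU : \forall u \near t, U u by exact: open_nbhs_nbhs.
  apply: filterS2 nU (cvg_le_near (cvg_energy Ut Cx ov)) => u Uu Eu uab.
  by rewrite (sqr_tnorm_velocity ab uab (rd u Uu) (Cx.1 u Uu)).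
exists (M + 1) => t tab; apply: le_sqr_bound (tnorm_ge0 _) _; exact: HM.
Qed.

(** Around every point of the closed piece, the squared norm agrees at interior times with a
    function continuous at that point. The ends are left out because there the acceleration relative
    to [[a, b]] also depends on the adjacent piece. *)
Lemma acceleration_bounded a b a' b' q : a <= a' -> a' < b' -> b' <= b ->
  smooth_curve a' b' q ->
  exists M, forall t, t \in `]a', b'[ -> tnorm (acceleration a b q t) ^+ 2 <= M.
Proof.
move=> aa' ab' bb' Cq.
have ab : a < b by rewrite (le_lt_trans aa')// (lt_le_trans ab').
have [M HM] : exists M, forall t, t \in `[a', b'] -> [set` `]a', b'[] t ->
    tnorm (acceleration a b q t) ^+ 2 <= M.
  apply: locally_bounded_segment => t tab.
  have [U [x [oU Ut Cx ov rd]]] := regular_reads Cq tab.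
  have cacc := cvg_sqr_acceleration Ut (Cx 2) ov.
  have nU u : U u -> \forall v \near u, U v by move=> Uu; exact: open_nbhs_nbhs.
  eexists.
  apply: filterS2 (nU t Ut) (cvg_le_near cacc) => u Uu Eu uab.
  have uab' : u \in `[a, b].
    move: uab; rewrite /= !in_itv/= => /andP[au ub].
    by rewrite (le_trans aa' (ltW au)) (le_trans (ltW ub)).
  apply: le_trans Eu; rewrite le_eqVlt; apply/orP; left; apply/eqP.
  apply: sqr_tnorm_acceleration ab uab' _ _ _.
  - exact: chart_reads_interior uab (rd u Uu).
  - by apply: filterS (nU u Uu) => v Uv; exact: (Cx 2).1.
  - by apply: diff_derivable; exact: ((Cx 2).2 1).1.
by exists M => t tab; apply: HM => //; exact: subset_itv_oo_cc.
Qed.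

Lemma energy_ge0 c x t : overlap c c (x t) -> 0 <= energy c x t.
Proof.
by move=> [p [cp _] xE]; rewrite /energy -xE bil_gram//; exact: metric_ge0.
Qed.

Lemma is_derive_speed c x t : overlap c c (x t) -> differentiable x t ->
  derivable ('D_1 x) t 1 ->
  is_derive t 1 (fun u => Num.sqrt (1 + energy c x u))
    (lowered_acc (gram (@metric R n Q) c) x t ('D_1 x t) / Num.sqrt (1 + energy c x t)).
Proof.
move=> ov dx ddx; have E0 := energy_ge0 ov.
have pos : 0 < 1 + energy c x t by rewrite ltr_wpDr.
have d1 : is_derive t 1 (fun u => 1 + energy c x u)
    (0 + 2 * lowered_acc (gram (@metric R n Q) c) x t ('D_1 x t)).
  by apply: is_deriveD (is_derive_cst _ _ _) (is_derive_energy ov dx ddx).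
have d2 := is_derive1_sqrt pos.
have := @is_derive1_comp R Num.sqrt (fun u => 1 + energy c x u) t _ _ d2 d1.
move=> d3; apply: (is_derive_eq d3); rewrite add0r.
by field; rewrite gt_eqF ?sqrtr_gt0.
Qed.

(** The 1 keeps the root differentiable where the velocity vanishes, while [speed] still dominates
    the norm of the velocity. *)
Definition speed a b q t : R := Num.sqrt (1 + tnorm (velocity a b q t) ^+ 2).

(** By Cauchy-Schwarz, [speed] has derivative <D^2q/dt^2, q'> / speed <= |D^2q/dt^2| <= 1 +
    |D^2q/dt^2|^2. The C^1 hypothesis on [[a, b]] identifies [speed a b] with the speed of the
    smooth piece, its ends included. *)
Lemma speed_growth a b a' b' u v q : C1_curve a b q -> smooth_curve a' b' q ->
  a <= a' -> b' <= b -> a' <= u -> u < v -> v <= b' ->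
  ((speed a b q v - speed a b q u - (v - u))%:E <=
   \int[mu]_(t in `[u, v]) (tnorm (acceleration a b q t) ^+ 2)%:E)%E.
Proof.
move=> Cq Sq aa' bb' a'u uv vb'.
have ab' : a' < b' by rewrite (le_lt_trans a'u)// (lt_le_trans uv).
have ab : a < b by rewrite (le_lt_trans aa')// (lt_le_trans ab').
have sub t : t \in `[u, v] -> t \in `[a', b'].
  by rewrite !in_itv/= => /andP[ut tv]; rewrite (le_trans a'u)// (le_trans tv).
have sub' t : t \in `[a', b'] -> t \in `[a, b].
  by rewrite !in_itv/= => /andP[a't tb']; rewrite (le_trans aa')// (le_trans tb').
have loc t : t \in `[u, v] -> exists x,
    [/\ \forall s \near t, is_derive (s : R) 1 (fun s : R => Num.sqrt (1 + energy (q t) x s))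
       (lowered_acc (gram (@metric R n Q) (q t)) x s ('D_1 x s) / Num.sqrt (1 + energy (q t) x s)),
      (fun s => lowered_acc (gram (@metric R n Q) (q t)) x s ('D_1 x s)
         / Num.sqrt (1 + energy (q t) x s)) @ t -->
         lowered_acc (gram (@metric R n Q) (q t)) x t ('D_1 x t)
         / Num.sqrt (1 + energy (q t) x t),
      \forall s \near t, s \in `[u, v] ->
        speed a b q s = Num.sqrt (1 + energy (q t) x s) &
      t \in `]u, v[ ->
        lowered_acc (gram (@metric R n Q) (q t)) x t ('D_1 x t) =
        bil (metric (q t)) (acceleration a b q t) (velocity a b q t)].
  move=> tuv; have [U [x [oU Ut Cx ov rd]]] := regular_reads Sq (sub t tuv).
  have nU s : U s -> \forall v \near s, U v by move=> Us; exact: open_nbhs_nbhs.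
  have cx : {for t, continuous x} by apply: differentiable_continuous; exact: (Cx 1).1.
  have dx s : U s -> differentiable x s by exact: (Cx 1).1.
  have ddx s : U s -> derivable ('D_1 x) s 1.
    by move=> Us; apply: diff_derivable; exact: ((Cx 2).2 1).1.
  exists x; split.
  - apply: filterS2 (nU t Ut) (near_overlap cx ov) => s Us ovs.
    exact: is_derive_speed ovs (dx s Us) (ddx s Us).
  - have c1 : {for t, continuous ('D_1 x)} by exact: ((Cx 1).2 1).
    have c2 := cvg_lowered_acc Ut (Cx 2) ov c1.
    have c3 := cvg_energy Ut (Cx 1) ov.
    have c4 : (fun s => Num.sqrt (1 + energy (q t) x s)) @ t --> Num.sqrt (1 + energy (q t) x t).
      apply: (cvg_comp (fun s => 1 + energy (q t) x s) Num.sqrt).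
        by apply: cvgD; [exact: cvg_cst | exact: c3].
      exact: sqrt_continuous.
    apply: cvgM; first exact: c2.
    apply: cvgV; last exact: c4.
    by rewrite gt_eqF// sqrtr_gt0 ltr_wpDr// energy_ge0.
  - apply: filterS (nU t Ut) => s Us suv; have sab := sub s suv.
    rewrite /speed (velocity_sub aa' ab' bb' sab Cq).
    by rewrite (sqr_tnorm_velocity ab' sab (rd s Us) (dx s Us)).
  - move=> touv.
    have toab : t \in `]a', b'[.
      move: touv; rewrite !in_itv/= => /andP[ut tv].
      by rewrite (le_lt_trans a'u)// (lt_le_trans tv).
    have tab := sub' t (sub t tuv).
    have rd' := chart_reads_interior a b toab (rd t Ut).
    rewrite (velocity_read ab tab rd' (dx t Ut)).
    rewrite (acceleration_lowered _ ab tab rd' _ (ddx t Ut))//.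
    by apply: filterS (nU t Ut) => s Us; exact: dx.
(* The drift is [k = 1], the constant in A <= 1 + A^2. *)
rewrite -[v - u]mul1r; apply: FTC_le_drift => // t tuv.
- have [x [dy cy gy _]] := loc t tuv.
  exists (fun s => Num.sqrt (1 + energy (q t) x s)); split => //.
    by apply: filterS dy => s [].
  rewrite /prop_for /continuous_at (derive_val (is_derive := nbhs_singleton dy)).
  apply: cvg_trans cy; apply: near_eq_cvg.
  by apply: filterS dy => s [_ ->].
- have tuv' : t \in `[u, v] by exact: subset_itv_oo_cc.
  have [x [dy cy gy /(_ tuv) lE]] := loc t tuv'.
  have -> : 'D_1 (speed a b q) t =
      lowered_acc (gram (@metric R n Q) (q t)) x t ('D_1 x t) / Num.sqrt (1 + energy (q t) x t).
    have [_ <-] := nbhs_singleton dy; apply: near_eq_derive.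
    by apply: filterS2 (near_itv_oo tuv) gy => s suv /(_ suv).
  rewrite lE -(nbhs_singleton gy tuv').
  set A := tnorm (acceleration a b q t); set v' := tnorm (velocity a b q t).
  have A0 : 0 <= A := tnorm_ge0 _; have v0 : 0 <= v' := tnorm_ge0 _.
  have CS : bil (metric (q t)) (acceleration a b q t) (velocity a b q t) <= A * v'.
    exact: le_trans (ler_norm _) (cauchy_schwarz _ _).
  have sp : 0 < speed a b q t by rewrite sqrtr_gt0 ltr_wpDr ?sqr_ge0.
  have vsp : v' <= speed a b q t.
    have s2 : speed a b q t ^+ 2 = 1 + v' ^+ 2 by rewrite sqr_sqrtr// addr_ge0// sqr_ge0.
    have := ltW sp; nra.
  rewrite ler_pdivrMr// (le_trans CS)//.
  rewrite (@le_trans _ _ (A * speed a b q t))// ?ler_wpM2l// ler_wpM2r ?(ltW sp)//.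
  (* (A - 1)^2 >= 0 gives 2A <= 1 + A^2. *)
  by have := sqr_ge0 (A - 1); rewrite sqrrB1; lra.
- exact: sqr_ge0.
Qed.

End SpeedBounds.

(** * Lengths and distances *)

Section Lengths.
Context (R : realType) (n : nat) (Q : riemannianManifold R n).
Implicit Types (a b c d t u : R) (q w z : R -> Q).
Notation mu := (@lebesgue_measure R).

Lemma deriv_on_local (W : normedModType R) a b a' b' t (f g : R -> W) :
  t \in `]a, b[ -> t \in `]a', b'[ -> (\forall u \near t, f u = g u) ->
  deriv_on a b f t = deriv_on a' b' g t.
Proof.
move=> tab tab' fg; rewrite /deriv_on; congr (lim _).
have shift0 (P : set R) : (\forall u \near t, P u) -> \forall h \near (0 : R), P (t + h).
  by move=> nP; apply: (@cvgD _ _ _ _ _ (cst t) id t 0 (cvg_cst t) cvg_id); rewrite addr0.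
have n1 := shift0 _ (near_itv_oo tab); have n2 := shift0 _ (near_itv_oo tab').
have n3 := shift0 _ fg; have ft : f t = g t := nbhs_singleton fg.
have dnbhs0 (D P : set R) : (within D (0 : R)^') P <->
    \forall h \near (0 : R), h != 0 -> D h -> P h.
  by [].
apply/seteqP; split=> A /dnbhs0 HA; apply/dnbhs0.
  by apply: filterS3 HA n1 n3 => h HAh h1 h3 h0 _; have := HAh h0 h1; rewrite /= ft h3.
by apply: filterS3 HA n2 n3 => h HAh h1 h3 h0 _; have := HAh h0 h1; rewrite /= ft h3.
Qed.

Lemma tnorm_velocity_local a b a' b' t q w : t \in `]a, b[ -> t \in `]a', b'[ ->
  {in `[a', b'], q =1 w} ->
  tnorm (velocity a b q t) = tnorm (velocity a' b' w t).
Proof.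
move=> tab tab' qw; have qwt : q t = w t by apply: qw; exact: subset_itv_oo_cc.
have -> : velocity a b q t = velocity a' b' w t :> 'rV[R]_n.
  rewrite /velocity qwt; apply: deriv_on_local => //.
  by apply: filterS (near_itv_oo tab') => u uab; rewrite qw.
by rewrite /tnorm qwt.
Qed.

Lemma regular_curve_eq reg a b q w : {in `[a, b], q =1 w} ->
  regular_curve reg a b q -> regular_curve reg a b w.
Proof.
move=> qw qreg t tab; have [U [x [oU Ut rx qx]]] := qreg t tab.
exists U, x; split => // u Uu uab; rewrite -qw// -qw//; exact: qx.
Qed.

Lemma piecewise_eq reg a b q w : {in `[a, b], q =1 w} ->
  piecewise (@regular_curve R n Q reg) a b q -> piecewise (@regular_curve R n Q reg) a b w.
Proof.
move=> qw [s [sab qs]]; exists s; split => // i si.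
apply: (@regular_curve_eq _ _ _ q); last exact: qs.
move=> u; rewrite in_itv/= => /andP[u1 u2]; apply: qw; rewrite in_itv/=.
rewrite (le_trans _ u1) ?(itv_partition_nth_ge _ sab)//; last exact: ltnW.
by rewrite (le_trans u2)// (itv_partition_nth_le (m := i.+1) _ sab).
Qed.

Lemma piecewise_cat (C : R -> R -> (R -> Q) -> Prop) a b c q :
  piecewise C a b q -> piecewise C b c q -> piecewise C a c q.
Proof.
move=> [s [sab qs]] [t [tbc qt]]; exists (s ++ t); split; first exact: itv_partition_cat tbc.
move=> i; rewrite size_cat => ist.
have [si|si] := ltnP i (size s).
  have := qs i si; rewrite -cat_cons !nth_cat/= si ltnS (ltnW si).
  by rewrite (set_nth_default c b)/= ?ltnS ?(ltnW si)// (set_nth_default c b si).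
have it : (i - size s < size t)%N by rewrite ltn_subLR.
have := qt _ it; rewrite (nth_cat _ s) ltnNge si/=.
suff -> : nth c (a :: s ++ t) i = nth c (b :: t) (i - size s) by [].
(* For [i = size s] the left end of the cell is the last point of [a :: s], which is [b]. *)
rewrite -cat_cons nth_cat/= ltnS; have [lei|] := leqP i (size s).
  have -> : i = size s by apply/eqP; rewrite eqn_leq lei.
  rewrite subnn/=; case: sab => _ /eqP <-.
  by rewrite -nth_last/= (set_nth_default a c)/=; case: (s).
by move=> lti; rewrite -[(i - size s)%N in RHS]prednK ?subn_gt0//= subnS.
Qed.

Lemma piecewise1 (C : R -> R -> (R -> Q) -> Prop) a b q : a < b -> C a b q -> piecewise C a b q.
Proof. by move=> ab Cq; exists [:: b]; split; [exact: itv_partition1 | case]. Qed.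

Lemma length_integral_eq a b a' b' q w : a <= a' -> b' <= b -> a' < b' ->
  {in `[a', b'], q =1 w} ->
  (\int[mu]_(t in `[a', b']) (tnorm (velocity a b q t))%:E =
   \int[mu]_(t in `[a', b']) (tnorm (velocity a' b' w t))%:E)%E.
Proof.
move=> aa' bb' ab' qw.
(* At [a'] and [b'] the two velocities may differ, so only the open interval is compared. *)
have E (v : R -> R) : (forall t, 0 <= v t) ->
    (\int[mu]_(t in `[a', b']) (v t)%:E = \int[mu]_(t in `]a', b'[) (v t)%:E)%E.
  by move=> v0; apply: ge0_integral_itv_oo_cc (ltW ab') _ => t _; rewrite lee_fin.
apply: etrans (E _ (fun t => tnorm_ge0 _)) _.
apply: etrans _ (esym (E _ (fun t => tnorm_ge0 _))).
apply: eq_integral => t; rewrite inE/= => tab'; congr (_%:E).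
apply: (tnorm_velocity_local _ tab' qw).
by move: tab'; rewrite !in_itv/= => /andP[? ?]; rewrite (le_lt_trans aa')// (lt_le_trans _ bb').
Qed.

(** [curve_length] is a real-valued integral, which would turn an infinite value into 0; finiteness
    is what makes lengths additive. *)
Lemma length_integral_lty a b q : a < b -> piecewise (@C1_curve R n Q) a b q ->
  (\int[mu]_(t in `[a, b]) (tnorm (velocity a b q t))%:E < +oo)%E.
Proof.
move=> ab [s [sab qs]].
have N0 t : (0 <= (tnorm (velocity a b q t))%:E)%E by rewrite lee_fin tnorm_ge0.
apply: (@itv_partition_ind R (fun x y =>
  \int[mu]_(t in `[x, y]) (tnorm (velocity a b q t))%:E < +oo)%E a b s) => //.
- by move=> x; rewrite set_itv1 integral_set1.
- move=> x y z /andP[_ xy] /andP[yz _] Pxy Pyz.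
  by rewrite (@ge0_integral_itv_split _ _ y)// ?xy// lte_add_pinfty.
move=> i si; set x := nth _ _ _; set y := nth _ _ _.
have xy : x < y.
  have /(pathP b)/(_ i si) : path <%R a s by case: sab.
  by [].
have ax : a <= x by apply: itv_partition_nth_ge sab; exact: ltnW.
have yb : y <= b by exact: (itv_partition_nth_le (m := i.+1) _ sab).
have [M HM] := velocity_bounded xy (qs i si).
rewrite (@length_integral_eq _ _ _ _ q q)//.
apply: (@le_lt_trans _ _ (\int[mu]_(t in `[x, y]) (M%:E))%E).
  apply: ge0_le_integral_lower => t /= txy; first by rewrite lee_fin tnorm_ge0.
  by rewrite lee_fin HM.
rewrite integral_cst//= lebesgue_measure_itv/= lte_fin xy -EFinD -EFinM.
exact: ltry.
Qed.

Lemma curve_length_ge0 a b q : 0 <= curve_length a b q.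
Proof.
rewrite /curve_length /Rintegral fine_ge0// integral_ge0// => t _.
by rewrite lee_fin tnorm_ge0.
Qed.

Lemma curve_length_cat a b c q : a < b -> b < c ->
  piecewise (@C1_curve R n Q) a b q -> piecewise (@C1_curve R n Q) b c q ->
  curve_length a c q = curve_length a b q + curve_length b c q.
Proof.
move=> ab bc qab qbc.
rewrite /curve_length /Rintegral (@ge0_integral_itv_split _ a b c) ?(ltW ab) ?(ltW bc)//; last first.
  by move=> t _; rewrite lee_fin tnorm_ge0.
rewrite (@length_integral_eq a c a b q q)// ?(ltW bc)//.
rewrite (@length_integral_eq a c b c q q)// ?(ltW ab)//.
rewrite fineD// ge0_fin_numE ?length_integral_lty// integral_ge0// => t _;
  by rewrite lee_fin tnorm_ge0.
Qed.

Lemma curve_length_eq a b q w : a < b -> {in `[a, b], q =1 w} ->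
  curve_length a b q = curve_length a b w.
Proof.
move=> ab qw; rewrite /curve_length /Rintegral.
exact: (f_equal fine (@length_integral_eq a b a b q w (lexx a) (lexx b) ab qw)).
Qed.

(** Kept apart from [dist] because [inf] of the empty set is 0: the existence of a joining curve has
    to be carried along as a separate fact. *)
Definition joins (p p' : Q) (l : R) : Prop := exists (a b : R) (w : R -> Q),
  [/\ a < b, piecewise (@C1_curve R n Q) a b w, w a = p, w b = p' &
      l = curve_length a b w].

Lemma distE (p p' : Q) : dist p p' = inf [set l | joins p p' l].
Proof. by []. Qed.

Lemma joins_ge0 p p' l : joins p p' l -> 0 <= l.
Proof. by move=> [a [b [w [_ _ _ _ ->]]]]; exact: curve_length_ge0. Qed.

Lemma dist_ge0 (p p' : Q) : 0 <= dist p p'.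
Proof.
rewrite distE; have [->|/set0P S0] := eqVneq [set l | joins p p' l] set0.
  by rewrite inf0.
by apply: lb_le_inf => // l; exact: joins_ge0.
Qed.

Lemma dist_le p p' l : joins p p' l -> dist p p' <= l.
Proof. by move=> pp'l; apply: ge_inf => //; exists 0 => l'; exact: joins_ge0. Qed.

(** Slope 1 shifts a piece in time for gluing and slope -1 reverses it; in both cases the speed
    bound is unchanged. *)
Lemma affine_piece a b c d q sg be L : (sg = 1 \/ sg = -1) -> a < b -> c < d ->
  (forall u, u \in `[c, d] -> sg * u + be \in `[a, b]) ->
  C1_curve a b q -> (forall t, t \in `[a, b] -> tnorm (velocity a b q t) <= L) ->
  C1_curve c d (fun u => q (sg * u + be)) /\
  forall u, u \in `[c, d] -> tnorm (velocity c d (fun u => q (sg * u + be)) u) <= L.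
Proof.
move=> sg1 ab cd cdab Cq qL.
have sgn : `|sg| = 1 by case: sg1 => ->; rewrite ?normrN normr1.
pose A (u : R) := sg * u + be.
have cA : continuous A.
  by move=> u; apply: cvgD; [apply: cvgM; [exact: cvg_cst | exact: cvg_id] | exact: cvg_cst].
have dA (u w : R) : is_derive u w A (sg *: w).
  have -> : sg *: w = sg *: w + 0 by rewrite addr0.
  exact: is_deriveD (is_deriveZ sg (is_derive_id u w)) (is_derive_cst be u w).
have dAd (u : R) : differentiable A u by apply/derivable1_diffP; have [] := dA u 1.
have DA (U : set R) (x : R -> 'rV[R]_n) (u w : R) : Ck 1 U x -> U (A u) ->
    is_derive u w (x \o A) ('D_(sg *: w) x (A u)).
  move=> Cx UAu; have [_ <-] := dA u w.
  exact: is_derive_chain w (dAd u) (Cx.1 _ UAu).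
have CA (U : set R) (x : R -> 'rV[R]_n) : open U -> Ck 1 U x -> Ck 1 (A @^-1` U) (x \o A).
  move=> oU Cx; split=> [u Uu|w u Uu].
    exact: differentiable_comp (dAd u) (Cx.1 _ Uu).
  have nU : \forall s \near u, U (A s) by apply: cA; exact: open_nbhs_nbhs.
  have [_ E] := DA U x u w Cx Uu.
  rewrite /prop_for /continuous_at E.
  apply: (@cvg_trans _ (('D_(sg *: w) x \o A) @ u)).
    apply: near_eq_cvg; apply: filterS nU => s Us /=.
    by have [_ ->] := DA U x s w Cx Us.
  by apply: (cvg_comp A ('D_(sg *: w) x) (cA u)); exact: ((Cx.2 (sg *: w)) (A u) Uu).
pose z u := q (A u).
have rd u : u \in `[c, d] -> exists (U : set R) x, [/\ open U, U (A u), Ck 1 U x,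
    forall s, U s -> chart_reads (q (A u)) a b q x s &
    forall s, U (A s) -> s \in `[c, d] ->
      dom (z u) (z s) /\ chart_at (z u) (z s) = (x \o A) s].
  move=> ucd; have [U [x [oU Uu Cx qx]]] := Cq _ (cdab u ucd).
  exists U, x; split => //; last by move=> s Us /cdab; exact: qx.
  move=> s Us; have nU : \forall v \near s, U v by exact: open_nbhs_nbhs.
  by apply: filterS nU => v Uv vab; exact: qx.
have oA (U : set R) : open U -> open (A @^-1` U).
  by move=> oU; apply: open_comp => // ? _; exact: cA.
split=> u ucd; have [U [x [oU Uu Cx rdx zx]]] := rd u ucd.
  exists (A @^-1` U), (x \o A); split => //; [exact: oA | exact: CA].
have rdz : chart_reads (z u) c d z (x \o A) u.
  have nU : \forall s \near u, U (A s) by apply: cA; exact: open_nbhs_nbhs.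
  by apply: filterS nU => s Us scd; exact: zx.
have dxA : differentiable (x \o A) u := (CA U x oU Cx).1 u Uu.
have Vz : velocity c d z u = sg *: 'D_1 x (A u) :> 'rV[R]_n.
  rewrite (velocity_read cd ucd rdz dxA) (change_chart_id _ (mem_dom _)).
  have [_ ->] := DA U x u 1 Cx Uu.
  rewrite !deriveE; [|exact: Cx.1..].
  by rewrite linearZ.
have Vq : velocity a b q (A u) = 'D_1 x (A u) :> 'rV[R]_n.
  rewrite (velocity_read ab (cdab u ucd) (rdx _ Uu) (Cx.1 _ Uu)).
  exact: change_chart_id (mem_dom _).
have -> : velocity c d (fun u => q (sg * u + be)) u = sg *: velocity a b q (A u) :> 'rV[R]_n.
  by rewrite Vq -Vz.
have := @tnormZ R n Q (q (A u)) sg (velocity a b q (A u)).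
by rewrite sgn mul1r => ->; apply: qL; exact: cdab.
Qed.

Lemma curve_length_le a b q L : a < b ->
  (forall t, t \in `[a, b] -> tnorm (velocity a b q t) <= L) ->
  curve_length a b q <= L * (b - a).
Proof.
move=> ab qL; rewrite /curve_length /Rintegral.
have H : (\int[mu]_(t in `[a, b]) (tnorm (velocity a b q t))%:E <= (L * (b - a))%:E)%E.
  apply: (@le_trans _ _ (\int[mu]_(t in `[a, b]) (L%:E))%E).
    apply: ge0_le_integral_lower => t /= tab; first by rewrite lee_fin tnorm_ge0.
    by rewrite lee_fin qL.
  by rewrite integral_cst//= lebesgue_measure_itv/= lte_fin ab -EFinD -EFinM.
have fin : (\int[mu]_(t in `[a, b]) (tnorm (velocity a b q t))%:E)%E \is a fin_num.
  rewrite ge0_fin_numE; first exact: le_lt_trans H (ltry _).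
  by apply: integral_ge0 => t _; rewrite lee_fin tnorm_ge0.
by rewrite -lee_fin fineK.
Qed.

(** The arc [w] is shifted in time to start at [b], where the given curve ends, and the two are
    patched together. *)
Lemma joins_snoc (p p' : Q) l c d w L : joins p p' l -> c < d -> C1_curve c d w ->
  (forall t, t \in `[c, d] -> tnorm (velocity c d w t) <= L) ->
  w c = p' -> exists2 l', joins p (w d) l' & l' <= l + L * (d - c).
Proof.
move=> [a [b [v [ab vC1 va vb lE]]]] cd Cw wL wc.
pose e := b + (d - c); have be : b < e by rewrite ltrDl subr_gt0.
pose w' u := w (1 * u + (c - b)).
have [Cw' w'L] : C1_curve b e w' /\
    forall u, u \in `[b, e] -> tnorm (velocity b e w' u) <= L.
  apply: (@affine_piece c d b e w 1 (c - b) L) => //; first by left.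
  by move=> u; rewrite !in_itv/= /e mul1r => /andP[bu ue]; apply/andP; split; lra.
pose z u := if u <= b then v u else w' u.
have zv : {in `[a, b], v =1 z}.
  by move=> u; rewrite in_itv/= /z => /andP[_ ->].
have zw : {in `[b, e], w' =1 z}.
  move=> u; rewrite in_itv/= /z => /andP[bu _]; case: leP => // ub.
  have -> : u = b by apply/eqP; rewrite eq_le ub bu.
  by rewrite vb -wc /w'; congr w; ring.
have C1 := piecewise_eq zv vC1.
have C2 := piecewise_eq zw (piecewise1 be Cw').
exists (curve_length a e z).
  have za : z a = p by rewrite -zv ?in_itv/= ?lexx ?(ltW ab).
  have ze : z e = w d.
    by rewrite -zw ?in_itv/= ?lexx ?(ltW be)// /w' /e; congr w; ring.
  by exists a, e, z; exact: And5 (lt_trans ab be) (piecewise_cat C1 C2) za ze erefl.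
rewrite (curve_length_cat ab be C1 C2) lE -(curve_length_eq ab zv) lerD2l.
rewrite -(curve_length_eq be zw) (_ : d - c = e - b); last by rewrite /e; ring.
exact: curve_length_le.
Qed.

Lemma joins_cons (p p' : Q) l c d w L : joins p p' l -> c < d -> C1_curve c d w ->
  (forall t, t \in `[c, d] -> tnorm (velocity c d w t) <= L) ->
  w d = p -> exists2 l', joins (w c) p' l' & l' <= L * (d - c) + l.
Proof.
move=> [a [b [v [ab vC1 va vb lE]]]] cd Cw wL wd.
pose e := a - (d - c); have ea : e < a by rewrite ltrBlDr ltrDl subr_gt0.
pose w' u := w (1 * u + (d - a)).
have [Cw' w'L] : C1_curve e a w' /\
    forall u, u \in `[e, a] -> tnorm (velocity e a w' u) <= L.
  apply: (@affine_piece c d e a w 1 (d - a) L) => //; first by left.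
  by move=> u; rewrite !in_itv/= /e mul1r => /andP[eu ua]; apply/andP; split; lra.
pose z u := if u < a then w' u else v u.
have zv : {in `[a, b], v =1 z}.
  by move=> u; rewrite in_itv/= /z => /andP[au _]; rewrite ltNge au.
have zw : {in `[e, a], w' =1 z}.
  move=> u; rewrite in_itv/= /z => /andP[_ ua]; case: ltP => // au.
  have -> : u = a by apply/eqP; rewrite eq_le ua au.
  by rewrite va -wd /w'; congr w; ring.
have C1 := piecewise_eq zw (piecewise1 ea Cw').
have C2 := piecewise_eq zv vC1.
exists (curve_length e b z).
  have zb : z b = p' by rewrite -zv ?in_itv/= ?lexx ?(ltW ab).
  have ze : z e = w c.
    by rewrite -zw ?in_itv/= ?lexx ?(ltW ea)// /w' /e; congr w; ring.
  by exists e, b, z; exact: And5 (lt_trans ea ab) (piecewise_cat C1 C2) ze zb erefl.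
rewrite (curve_length_cat ea ab C1 C2) lE -(curve_length_eq ab zv) lerD2r.
rewrite -(curve_length_eq ea zw) (_ : d - c = a - e); last by rewrite /e; ring.
exact: curve_length_le.
Qed.

Lemma affine_between T L q t0 t : 0 < T -> C1_curve 0 T q ->
  (forall t, t \in `[0, T] -> tnorm (velocity 0 T q t) <= L) ->
  t0 \in `[0, T] -> t \in `[0, T] -> t0 != t -> exists w,
  [/\ C1_curve 0 `|t - t0| w, w 0 = q t0, w `|t - t0| = q t &
   forall u, u \in `[0, `|t - t0|] -> tnorm (velocity 0 `|t - t0| w u) <= L].
Proof.
move=> T0 Cq qL; rewrite !in_itv/= => /andP[t00 t0T] /andP[t_0 tT] tt0.
pose sg : R := if t0 < t then 1 else -1.
have sg1 : sg = 1 \/ sg = -1 by rewrite /sg; case: ifP; [left|right].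
have d0 : 0 < `|t - t0| by rewrite normr_gt0 subr_eq0 eq_sym.
have sgE : sg * `|t - t0| + t0 = t.
  rewrite /sg; case: ltP => h; first by rewrite gtr0_norm ?subr_gt0//; ring.
  by rewrite ler0_norm ?subr_le0//; ring.
have sub u : u \in `[0, `|t - t0|] -> sg * u + t0 \in `[0, T].
  rewrite !in_itv/= => /andP[u0 ud]; apply/andP; split; case: sg1 sgE => -> sgE; lra.
have [Cw wL] := affine_piece sg1 T0 d0 sub Cq qL.
exists (fun u => q (sg * u + t0)); split => //.
  by rewrite mulr0 add0r.
by rewrite sgE.
Qed.

Lemma affine_between_rev T L q t0 t : 0 < T -> C1_curve 0 T q ->
  (forall t, t \in `[0, T] -> tnorm (velocity 0 T q t) <= L) ->
  t0 \in `[0, T] -> t \in `[0, T] -> t0 != t -> exists w,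
  [/\ C1_curve 0 `|t - t0| w, w 0 = q t, w `|t - t0| = q t0 &
   forall u, u \in `[0, `|t - t0|] -> tnorm (velocity 0 `|t - t0| w u) <= L].
Proof.
move=> T0 Cq qL ht0 ht tt0; rewrite distrC.
by apply: (affine_between T0 Cq qL ht ht0); rewrite eq_sym.
Qed.

(** The new curve runs from [q1 t] back along the first trajectory to [q1 t0], then to [q2 t0], then
    along the second trajectory to [q2 t]; each added arc has length at most L |t - t0|. *)
Lemma joins_move T L q1 q2 t0 t l : 0 < T -> C1_curve 0 T q1 -> C1_curve 0 T q2 ->
  (forall t, t \in `[0, T] -> tnorm (velocity 0 T q1 t) <= L) ->
  (forall t, t \in `[0, T] -> tnorm (velocity 0 T q2 t) <= L) ->
  t0 \in `[0, T] -> t \in `[0, T] -> joins (q1 t0) (q2 t0) l ->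
  exists2 l', joins (q1 t) (q2 t) l' & l' <= l + 2 * L * `|t - t0|.
Proof.
move=> T0 C1 C2 L1 L2 ht0 ht jl; have [<-|tt0] := eqVneq t0 t.
  by exists l => //; rewrite subrr normr0 mulr0 addr0.
have d0 : 0 < `|t - t0| by rewrite normr_gt0 subr_eq0 eq_sym.
have [w1 [Cw1 w10 w1d w1L]] := affine_between_rev T0 C1 L1 ht0 ht tt0.
have [w2 [Cw2 w20 w2d w2L]] := affine_between T0 C2 L2 ht0 ht tt0.
have [l1 j1 l1le] := joins_snoc jl d0 Cw2 w2L w20.
have [l2 j2 l2le] := joins_cons j1 d0 Cw1 w1L w1d.
exists l2; first by rewrite -w10 -w2d.
by move: l1le l2le; rewrite subr0 => l1le l2le; lra.
Qed.

(** Infimum over the curves of [joins_move]. The existence hypothesis rules out that [dist] at [t0]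
    is the default value 0 of an empty infimum. *)
Lemma dist_move T L q1 q2 t0 t : 0 < T -> C1_curve 0 T q1 -> C1_curve 0 T q2 ->
  (forall t, t \in `[0, T] -> tnorm (velocity 0 T q1 t) <= L) ->
  (forall t, t \in `[0, T] -> tnorm (velocity 0 T q2 t) <= L) ->
  t0 \in `[0, T] -> t \in `[0, T] -> (exists l, joins (q1 t0) (q2 t0) l) ->
  dist (q1 t) (q2 t) <= dist (q1 t0) (q2 t0) + 2 * L * `|t - t0|.
Proof.
move=> T0 C1 C2 L1 L2 ht0 ht ex; apply/ler_addgt0Pr => e e0.
have hinf : has_inf [set l | joins (q1 t0) (q2 t0) l].
  by split=> //; exists 0 => l; exact: joins_ge0.
have [l jl lle] := inf_adherent e0 hinf.
have [l' jl' l'le] := joins_move T0 C1 C2 L1 L2 ht0 ht jl.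
rewrite (le_trans (dist_le jl'))// (le_trans l'le)// addrAC lerD2r.
exact: ltW.
Qed.

Lemma joins_of_dist_gt0 (p p' : Q) : 0 < dist p p' -> exists l, joins p p' l.
Proof.
rewrite distE; have [->|/set0P//] := eqVneq [set l | joins p p' l] set0.
by rewrite inf0 ltxx.
Qed.

End Lengths.

(** * Costs and potentials *)

Section Costs.
Context (R : realType) (n : nat) (Q : riemannianManifold R n).
Implicit Types (q : R -> Q).
Notation mu := (@lebesgue_measure R).

(** The constant [k] sits inside the integral, ready for the bound on the potential terms, so that
    no additivity in the integrand is called upon. *)
Lemma acceleration_integral_lty T q k : 0 < T -> 0 <= k ->
  piecewise (@smooth_curve R n Q) 0 T q ->
  (\int[mu]_(t in `[0%R, T]) (tnorm (acceleration 0 T q t) ^+ 2 + k)%:E < +oo)%E.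
Proof.
move=> T0 k0 [s [sT qs]].
have N0 t : (0 <= (tnorm (acceleration 0 T q t) ^+ 2 + k)%:E)%E.
  by rewrite lee_fin addr_ge0// sqr_ge0.
apply: (@itv_partition_ind R (fun x y =>
  \int[mu]_(t in `[x, y]) (tnorm (acceleration 0 T q t) ^+ 2 + k)%:E < +oo)%E 0 T s) => //.
- by move=> x; rewrite set_itv1 integral_set1.
- move=> x y z /andP[_ xy] /andP[yz _] Pxy Pyz.
  by rewrite (@ge0_integral_itv_split _ _ y)// ?xy// lte_add_pinfty.
move=> i si; set x := nth _ _ _; set y := nth _ _ _.
have xy : x < y by have /(pathP T)/(_ i si) : path <%R 0 s by case: sT.
have ax : 0 <= x by apply: itv_partition_nth_ge sT; exact: ltnW.
have yb : y <= T by exact: (itv_partition_nth_le (m := i.+1) _ sT).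
have [M HM] := acceleration_bounded ax xy yb (qs i si).
rewrite ge0_integral_itv_oo_cc ?(ltW xy)//.
apply: (@le_lt_trans _ _ (\int[mu]_(t in `]x, y[) ((M + k)%:E))%E).
  apply: ge0_le_integral_lower => t /= txy; first exact: N0.
  by rewrite lee_fin lerD2r HM.
rewrite integral_cst//= lebesgue_measure_itv/= lte_fin xy -EFinD -EFinM.
exact: ltry.
Qed.

Lemma speed_bound T q K : 0 < T -> C1_curve 0 T q ->
  piecewise (@smooth_curve R n Q) 0 T q ->
  (\int[mu]_(t in `[0%R, T]) (tnorm (acceleration 0 T q t) ^+ 2)%:E <= K%:E)%E ->
  forall t, t \in `[0, T] -> tnorm (velocity 0 T q t) <= speed 0 T q 0 + T + K.
Proof.
move=> T0 Cq [s [sT qs]] HK t.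
have N0 u : (0 <= (tnorm (acceleration 0 T q u) ^+ 2)%:E)%E by rewrite lee_fin sqr_ge0.
(* Stated for all subintervals, the growth estimate survives concatenation at a breakpoint. *)
pose P x y := forall u v, x <= u -> u <= v -> v <= y ->
  ((speed 0 T q v - speed 0 T q u - (v - u))%:E <=
   \int[mu]_(t in `[u, v]) (tnorm (acceleration 0 T q t) ^+ 2)%:E)%E.
have Puu u : ((speed 0 T q u - speed 0 T q u - (u - u))%:E <=
   \int[mu]_(t in `[u, u]) (tnorm (acceleration 0 T q t) ^+ 2)%:E)%E.
  by rewrite !subrr set_itv1 integral_set1.
have PT : P 0 T.
  apply: (@itv_partition_ind R P 0 T s) => //.
  - move=> x u v xu uv vx; have uE : u = x by apply/eqP; rewrite eq_le xu (le_trans uv).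
    have vE : v = x by apply/eqP; rewrite eq_le vx (le_trans xu).
    by rewrite uE vE; exact: Puu.
  - move=> x y z _ _ Pxy Pyz u v xu uv vz.
    have [vy|yv] := leP v y; first exact: Pxy.
    have [yu|uy] := leP y u; first exact: Pyz.
    rewrite (@ge0_integral_itv_split _ u y v)// ?(ltW uy) ?(ltW yv)//.
    have -> : speed 0 T q v - speed 0 T q u - (v - u) =
      (speed 0 T q y - speed 0 T q u - (y - u)) + (speed 0 T q v - speed 0 T q y - (v - y)).
      by move: (speed 0 T q v) (speed 0 T q u) (speed 0 T q y) => *; ring.
    rewrite EFinD; apply: leeD; [exact: (Pxy u y xu (ltW uy) (lexx y))|].
    exact: (Pyz y v (lexx y) (ltW yv) vz).
  - move=> i si u v xu; rewrite le_eqVlt => /predU1P[<- _|uv vy]; first exact: Puu.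
    apply: speed_growth Cq (qs i si) _ _ xu uv vy.
      by apply: itv_partition_nth_ge sT; exact: ltnW.
    exact: (itv_partition_nth_le (m := i.+1) _ sT).
rewrite in_itv/= => /andP[t0 tT].
have H : ((speed 0 T q t - speed 0 T q 0 - (t - 0))%:E <= K%:E)%E.
  apply: (le_trans (PT 0 t (lexx 0) t0 tT)); apply: le_trans HK.
  apply: ge0_subset_integral_lower => //.
  by apply: subset_itvl; rewrite bnd_simp.
have vs : tnorm (velocity 0 T q t) <= speed 0 T q t.
  rewrite -[leLHS]ger0_norm ?tnorm_ge0// -sqrtr_sqr ler_wsqrtr// lerDr//.
move: H vs; rewrite lee_fin; move: (speed 0 T q t) (speed 0 T q 0) (tnorm _) => *; lra.
Qed.

Context (s : nat) (T : R) (E : rel 'I_s).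

Lemma cost_le (V : 'I_s -> 'I_s -> Q -> Q -> R) (q : 'I_s -> R -> Q) (C : R) i :
  (forall i j p p', E i j -> 0 <= V i j p p') ->
  (cost T E V q <= C%:E)%E ->
  (\int[mu]_(t in `[0%R, T])
     (tnorm (acceleration 0 T (q i) t) ^+ 2
      + 2^-1 * \sum_(j < s | E i j) V i j (q i t) (q j t))%R%:E <= (2 * C)%:E)%E.
Proof.
move=> V0 cC.
pose I k := (\int[mu]_(t in `[0%R, T]) (tnorm (acceleration 0 T (q k) t) ^+ 2
  + 2^-1 * \sum_(j < s | E k j) V k j (q k t) (q j t))%R%:E)%E.
have I0 k : (0 <= I k)%E.
  apply: integral_ge0 => t _; rewrite lee_fin addr_ge0 ?sqr_ge0// mulr_ge0//.
  by apply: sumr_ge0 => j Ekj; exact: V0.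
have ISum : (I i <= \sum_(k < s) I k)%E.
  by rewrite (bigD1 i)//= leeDl// sume_ge0.
by apply: (le_trans ISum); rewrite EFinM -lee_pdivrMl//; exact: cC.
Qed.

(** At most [s] neighbours contribute at most 1 each; the resulting bound contains neither epsilon
    nor k. *)
Lemma le_cost (V : 'I_s -> 'I_s -> Q -> Q -> R) (q : 'I_s -> R -> Q) : 0 < T ->
  (forall i j t, E i j -> t \in `[0, T] -> 0 <= V i j (q i t) (q j t) <= 1) ->
  (cost T E V q <= (2^-1)%:E * \sum_(i < s) \int[mu]_(t in `[0%R, T])
     (tnorm (acceleration 0 T (q i) t) ^+ 2 + s%:R)%:E)%E.
Proof.
move=> T0 V01; rewrite /cost; apply: lee_pmul => //.
  apply: sume_ge0 => i _; apply: integral_ge0 => t /= tT.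
  rewrite lee_fin addr_ge0 ?sqr_ge0// mulr_ge0//.
  by apply: sumr_ge0 => j Ekj; have /andP[] := V01 i j t Ekj tT.
apply: lee_sum => i _; apply: ge0_le_integral_lower => t /= tT.
  rewrite lee_fin addr_ge0 ?sqr_ge0// mulr_ge0//.
  by apply: sumr_ge0 => j Ekj; have /andP[] := V01 i j t Ekj tT.
rewrite lee_fin lerD2l.
apply: (@le_trans _ _ (\sum_(j < s | E i j) V i j (q i t) (q j t))).
  rewrite ler_piMl ?invf_le1 ?ler1n//.
  by apply: sumr_ge0 => j Ekj; have /andP[] := V01 i j t Ekj tT.
apply: (@le_trans _ _ (\sum_(j < s | E i j) 1)).
  by apply: ler_sum => j Eij; have /andP[] := V01 i j t Eij tT.
rewrite big_const_seq iter_addr addr0 ler_nat.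
rewrite (leq_trans (count_size _ _))// /index_enum -enumT size_enum_ord.
by [].
Qed.

Lemma potential_ge0 (D eps : R) k (p p' : Q) : 0 < D -> 0 < eps ->
  0 <= potential D eps k p p'.
Proof.
move=> D0 e0; rewrite /potential invr_ge0 addr_ge0 ?(ltW e0)// exprn_ge0//.
by rewrite divr_ge0 ?(ltW D0)// dist_ge0.
Qed.

Lemma potential_le1 (D eps : R) k (p p' : Q) : 0 < D -> 0 < eps -> D <= dist p p' ->
  potential D eps k p p' <= 1.
Proof.
move=> D0 e0 Dd; rewrite /potential invf_le1.
  by rewrite ler_wpDl ?(ltW e0)// exprn_ege1// ler_pdivlMr// mul1r.
rewrite ltr_pwDl// exprn_ge0// divr_ge0 ?(ltW D0)//; exact: dist_ge0.
Qed.

Lemma potential_ge (D eps m : R) k (p p' : Q) : 0 < D -> 0 < eps -> dist p p' <= m ->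
  (eps + (m / D) ^+ k)^-1 <= potential D eps k p p'.
Proof.
move=> D0 e0 dm; have d0 := dist_ge0 p p'; have m0 := le_trans d0 dm.
rewrite /potential lef_pV2 ?posrE.
- by rewrite lerD2l lerXn2r ?nnegrE ?divr_ge0 ?(ltW D0)// ler_pM2r ?invr_gt0.
- by rewrite ltr_pwDl// exprn_ge0// divr_ge0 ?(ltW D0).
- by rewrite ltr_pwDl// exprn_ge0// divr_ge0 ?(ltW D0).
Qed.

Lemma small_power (z e : R) : 0 <= z < 1 -> 0 < e ->
  exists2 k, (0 < k)%N & z ^+ k <= e.
Proof.
move=> /andP[z0 z1] e0.
have : (fun k => z ^+ k) @ \oo --> (0 : R) by apply: cvg_expr; rewrite ger0_norm.
move=> /cvgrPdist_le /(_ e e0) [N _ HN]; exists N.+1 => //.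
have := HN N.+1 (leqnSn N).
by rewrite /= sub0r normrN ger0_norm// exprn_ge0.
Qed.

(** The parameters are chosen as functions of two real numbers, not of two agents, so that symmetric
    tolerances give symmetric parameters. *)
Lemma choose_potential (delta : R -> R -> R) (C : R) :
  (forall D r, 0 < r < D -> 0 < delta D r) -> 0 < C ->
  exists ek : R -> R -> R * nat, forall D r, 0 < r < D ->
    [/\ 0 < (ek D r).1, (0 < (ek D r).2)%N &
      C < delta D r * ((ek D r).1 + (((r + D) / 2) / D) ^+ (ek D r).2)^-1].
Proof.
move=> d0 C0.
have H (Dr : R * R) : exists ek : R * nat, 0 < Dr.2 < Dr.1 ->
    [/\ 0 < ek.1, (0 < ek.2)%N &
      C < delta Dr.1 Dr.2 * (ek.1 + (((Dr.2 + Dr.1) / 2) / Dr.1) ^+ ek.2)^-1].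
  case: Dr => D r /=; have [rD|] := boolP (0 < r < D); last by exists (0, 0%N).
  have dl := d0 D r rD; case/andP: rD => r0 rD; have D0 := lt_trans r0 rD.
  (* With epsilon = e and the power at most e, the denominator is at most 2e = delta / (2C), so the
     product with delta is at least 2C. *)
  pose e := delta D r / (4 * C).
  have e0 : 0 < e by rewrite divr_gt0// mulr_gt0.
  have z01 : 0 <= (r + D) / 2 / D < 1.
    rewrite !divr_ge0 ?addr_ge0 ?(ltW r0) ?(ltW D0)//= ltr_pdivrMr// mul1r; lra.
  have [k k0 kle] := small_power z01 e0.
  exists (e, k) => _; split => //=.
  set z := _ ^+ k in kle *; have z0 : 0 <= z by rewrite exprn_ge0//; case/andP: z01.
  rewrite ltr_pdivlMr ?ltr_pwDl//.
  apply: (@le_lt_trans _ _ (C * (e + e))); first by rewrite ler_pM2l// lerD2l.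
  have -> : C * (e + e) = delta D r / 2 by rewrite /e; field; rewrite gt_eqF.
  by rewrite ltr_pdivrMr// ltr_pMr// ltr1n.
have [ek ekP] := choice H.
by exists (fun D r => ek (D, r)) => D r /(ekP (D, r)).
Qed.

End Costs.

(** * Collision avoidance *)

Section Avoidance.
Context (R : realType) (n : nat) (Q : riemannianManifold R n).
Context (s : nat) (T : R) (E : rel 'I_s).
Notation mu := (@lebesgue_measure R).

Lemma admissible_speed0 (q0 qT : 'I_s -> Q) (v0 : forall i, tangent (q0 i))
    (vT : forall i, tangent (qT i)) q i : admissible T v0 vT q ->
  speed 0 T (q i) 0 = Num.sqrt (1 + tnorm (v0 i) ^+ 2).
Proof.
move=> /(_ i)[_ _ [q0E vE] _]; rewrite /speed; congr (Num.sqrt (1 + _ ^+ 2)).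
by rewrite /tnorm vE q0E.
Qed.

(* The two agents remain within distance [m] of each other on an interval of
   length [delta] next to [t0]. *)
Lemma potential_integral_ge q1 q2 L D eps k r m delta C t0 : 0 < T ->
  C1_curve 0 T q1 -> C1_curve 0 T q2 ->
  (forall t, t \in `[0, T] -> tnorm (velocity 0 T q1 t) <= L) ->
  (forall t, t \in `[0, T] -> tnorm (velocity 0 T q2 t) <= L) ->
  0 < L -> 0 < D -> 0 < eps -> 0 < delta -> delta <= T / 2 -> r + 2 * L * delta <= m ->
  2 * C < delta * (eps + (m / D) ^+ k)^-1 ->
  t0 \in `[0, T] -> (exists l, joins (q1 t0) (q2 t0) l) -> dist (q1 t0) (q2 t0) <= r ->
  (C%:E < \int[mu]_(t in `[0%R, T]) (2^-1 * @potential R n Q D eps k (q1 t) (q2 t))%:E)%E.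
Proof.
move=> T0 C1 C2 L1 L2 L0 D0 e0 dl0 dlT rm Clt ht0 jt0 dr.
(* The interval extends to the right of [t0] if [t0] is in the first half of [[0, T]], to the left
   otherwise; it fits because [delta <= T / 2]. *)
have [al [al0 alT nearal]] : exists al, [/\ 0 <= al, al + delta <= T &
    forall t, al <= t <= al + delta -> `|t - t0| <= delta].
  move: ht0; rewrite in_itv/= => /andP[t00 t0T].
  have [h|h] := leP t0 (T / 2).
    exists t0; split => //; first by lra.
    by move=> t /andP[h1 h2]; rewrite ger0_norm; lra.
  exists (t0 - delta); split; [lra|lra|].
  by move=> t /andP[h1 h2]; rewrite ler0_norm; lra.
have sub t : al <= t <= al + delta -> t \in `[0, T].
  by rewrite in_itv/= => /andP[h1 h2]; apply/andP; split; lra.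
pose X := (eps + (m / D) ^+ k)^-1.
have lo : (C%:E < \int[mu]_(t in `[al, (al + delta)%R]) ((2^-1 * X)%:E))%E.
  rewrite integral_cst//= lebesgue_measure_itv/= lte_fin ltrDl dl0 -EFinD -EFinM lte_fin.
  rewrite addrAC subrr add0r; move: Clt; rewrite -/X; lra.
apply: (lt_le_trans lo).
apply: (@le_trans _ _ (\int[mu]_(t in `[al, (al + delta)%R])
    (2^-1 * @potential R n Q D eps k (q1 t) (q2 t))%:E)%E).
  have m0 : 0 <= m.
    have := dist_ge0 (q1 t0) (q2 t0); have : 0 <= 2 * L * delta.
      by rewrite mulr_ge0 ?(ltW dl0)// mulr_ge0// ltW.
    by move: (dist _ _) dr => dd; lra.
  have X0 : 0 <= X.
    rewrite invr_ge0 addr_ge0 ?(ltW e0)//; apply: exprn_ge0.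
    by rewrite divr_ge0// ltW.
  apply: ge0_le_integral_lower => t /=; rewrite in_itv/= => tal.
    by rewrite lee_fin mulr_ge0.
  rewrite lee_fin ler_pM2l//; apply: potential_ge => //.
  apply: le_trans (dist_move T0 C1 C2 L1 L2 ht0 (sub t tal) jt0) _.
  apply: le_trans rm; apply: lerD => //.
  by rewrite ler_pM2l ?mulr_gt0//; exact: nearal.
apply: ge0_subset_integral_lower => //.
  by move=> t _; rewrite lee_fin mulr_ge0// potential_ge0.
Qed.

End Avoidance.

Theorem corollary2 (R : realType) (n : nat) (Q : riemannianManifold R n)
    (Q_connected : connected [set: Q]) (Q_complete : complete_manifold Q)
    (s : nat) (s_ge2 : (2 <= s)%N) (T : R) (T_gt0 : 0 < T)
    (E : rel 'I_s) (E_sym : symmetric E) (E_irr : irreflexive E)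
    (q0 qT : 'I_s -> Q)
    (v0 : forall i, tangent (q0 i)) (vT : forall i, tangent (qT i))
    (Rtol : 'I_s -> 'I_s -> R)
    (Rtol_gt0 : forall i j, E i j -> 0 < Rtol i j)
    (Rtol_sym : forall i j, E i j -> Rtol i j = Rtol j i)
    (feasible : avoidance_feasible T E (admissible T v0 vT) Rtol)
    (r : 'I_s -> 'I_s -> R)
    (r_bounds : forall i j, E i j -> 0 < r i j < Rtol i j)
    (r_sym : forall i j, E i j -> r i j = r j i) :
  exists (eps : 'I_s -> 'I_s -> R) (k : 'I_s -> 'I_s -> nat),
    (forall i j, E i j ->
       [/\ 0 < eps i j, (0 < k i j)%N, eps i j = eps j i & k i j = k j i]) /\
    (forall q : 'I_s -> R -> Q,
       minimizer (admissible T v0 vT)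
         (cost T E (fun i j => potential (Rtol i j) (eps i j) (k i j))) q ->
       avoids_collision T E r q).
Proof.
have [w w_adm w_avoid] := feasible.
(* The cost of the feasible trajectory with each weighted sum of potentials replaced by [s]. *)
pose B := ((2^-1)%:E * \sum_(i < s) \int[lebesgue_measure]_(t in `[0%R, T])
     (tnorm (acceleration 0 T (w i) t) ^+ 2 + s%:R)%:E)%E.
have B0 : (0 <= B)%E.
  apply: mule_ge0 => //; apply: sume_ge0 => i _; apply: integral_ge0 => t _.
  by rewrite lee_fin addr_ge0 ?sqr_ge0.
have Bfin : B \is a fin_num.
  rewrite fin_numM//; apply/sum_fin_numP => i _ _.
  rewrite ge0_fin_numE; last by apply: integral_ge0 => t _; rewrite lee_fin addr_ge0 ?sqr_ge0.
  by have [_ Sw _ _] := w_adm i; exact: acceleration_integral_lty.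
pose C := fine B; have C0 : 0 <= C by exact: fine_ge0.
(* The sum dominates the initial [speed] of every agent, so one [L] serves them all. *)
pose sp0 := \sum_(i < s) Num.sqrt (1 + tnorm (v0 i) ^+ 2).
have sp00 : 0 <= sp0 by apply: sumr_ge0 => i _; exact: sqrtr_ge0.
pose L := sp0 + T + 2 * C.
have L0 : 0 < L by rewrite /L ltr_wpDr ?mulr_ge0// ltr_wpDl.
(* During a time delta the distance grows by at most 2 L delta <= (D - r) / 2, hence from [r] at
   most to the midpoint (r + D) / 2. *)
pose delta (D r : R) := Num.min (T / 2) ((D - r) / (4 * L)).
have delta0 D r' : 0 < r' < D -> 0 < delta D r'.
  by move=> /andP[_ rD]; rewrite lt_min !divr_gt0 ?mulr_gt0 ?subr_gt0.
(* The 4 undoes the two factors 1/2, in front of the cost and in front of the potentials; the 1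
   keeps the threshold positive when [C] is 0. *)
have [ek ekP] := choose_potential delta0 (ltr_wpDl (mulr_ge0 (ler0n R 4) C0) ltr01).
exists (fun i j => (ek (Rtol i j) (r i j)).1), (fun i j => (ek (Rtol i j) (r i j)).2).
have ekE i j : E i j -> [/\ 0 < (ek (Rtol i j) (r i j)).1, (0 < (ek (Rtol i j) (r i j)).2)%N &
    4 * C + 1 < delta (Rtol i j) (r i j) * ((ek (Rtol i j) (r i j)).1 +
      (((r i j + Rtol i j) / 2) / Rtol i j) ^+ (ek (Rtol i j) (r i j)).2)^-1].
  by move=> Eij; apply: ekP; exact: r_bounds.
split=> [i j Eij|q [q_adm q_min]].
  have [e0 k0 _] := ekE i j Eij; split=> //.
    by rewrite (Rtol_sym _ _ Eij) (r_sym _ _ Eij).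
  by rewrite (Rtol_sym _ _ Eij) (r_sym _ _ Eij).
set V := fun i j => _ in q_min.
have V0 i j p p' : E i j -> 0 <= V i j p p'.
  by move=> Eij; apply: potential_ge0; [exact: Rtol_gt0 | have [] := ekE i j Eij].
have q_cost : (cost T E V q <= C%:E)%E.
  rewrite /C fineK//; apply: le_trans (q_min w w_adm) _; apply: le_cost => // i j t Eij tT.
  rewrite V0//=; apply: potential_le1; first exact: Rtol_gt0.
    by have [] := ekE i j Eij.
  exact: w_avoid.
have int_le i := cost_le i V0 q_cost.
have V0s i t : 0 <= 2^-1 * \sum_(j < s | E i j) V i j (q i t) (q j t).
  by rewrite mulr_ge0// sumr_ge0// => j Eij; exact: V0.
have qL i t : t \in `[0, T] -> tnorm (velocity 0 T (q i) t) <= L.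
  move=> tT; have [Cq Sq _ _] := q_adm i.
  have K : (\int[lebesgue_measure]_(t in `[0%R, T])
      (tnorm (acceleration 0 T (q i) t) ^+ 2)%:E <= (2 * C)%:E)%E.
    apply: le_trans (int_le i); apply: ge0_le_integral_lower => u _ /=.
      by rewrite lee_fin sqr_ge0.
    by rewrite lee_fin lerDl V0s.
  apply: le_trans (speed_bound T_gt0 Cq Sq K tT) _.
  rewrite (admissible_speed0 i q_adm) /L !lerD2r /sp0 (bigD1 i)//= lerDl.
  by apply: sumr_ge0 => j _; exact: sqrtr_ge0.
move=> i j t0 Eij t0T; rewrite leNgt; apply/negP => coll.
have [e0 k0 eklt] := ekE i j Eij; have rb := r_bounds i j Eij.
have [Ci Si [qi0 _] _] := q_adm i; have [Cj Sj [qj0 _] _] := q_adm j.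
have [_ _ [wi0 _] _] := w_adm i; have [_ _ [wj0 _] _] := w_adm j.
have z0T : 0 \in `[0, T] by rewrite in_itv/= lexx ltW.
(* At time 0 the points are those of the feasible trajectory, whose distance is positive, so a
   joining curve exists; [joins_move] takes it to time [t0]. *)
have jt0 : exists l, joins (q i t0) (q j t0) l.
  have [l jl] : exists l, joins (q i 0) (q j 0) l.
    apply: joins_of_dist_gt0; rewrite qi0 qj0 -wi0 -wj0.
    exact: lt_le_trans (Rtol_gt0 i j Eij) (w_avoid i j 0 Eij z0T).
  by have [l' jl' _] := joins_move T_gt0 Ci Cj (qL i) (qL j) z0T t0T jl; exists l'.
have dl := delta0 _ _ rb.
have dlT : delta (Rtol i j) (r i j) <= T / 2 by rewrite ge_min lexx.
have rm : r i j + 2 * L * delta (Rtol i j) (r i j) <= (r i j + Rtol i j) / 2.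
  have : delta (Rtol i j) (r i j) <= (Rtol i j - r i j) / (4 * L) by rewrite ge_min lexx orbT.
  rewrite ler_pdivlMr ?mulr_gt0//; move: (delta _ _) => dd h; lra.
(* The potential of the single pair (i, j) is one nonnegative summand of the integrand of agent
   [i]. *)
have Vle : (\int[lebesgue_measure]_(t in `[0%R, T])
    (2^-1 * V i j (q i t) (q j t))%:E <= (2 * C)%:E)%E.
  apply: le_trans (int_le i); apply: ge0_le_integral_lower => t tT /=.
    by rewrite lee_fin mulr_ge0 ?V0.
  rewrite lee_fin ler_wpDl ?sqr_ge0// ler_wpM2l// (bigD1 j)//= lerDl.
  by apply: sumr_ge0 => j' /andP[Eij' _]; exact: V0.
have C4 : 2 * (2 * C) < delta (Rtol i j) (r i j) * ((ek (Rtol i j) (r i j)).1 +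
      (((r i j + Rtol i j) / 2) / Rtol i j) ^+ (ek (Rtol i j) (r i j)).2)^-1.
  by apply: lt_trans eklt; lra.
have := potential_integral_ge T_gt0 Ci Cj (qL i) (qL j) L0 (Rtol_gt0 i j Eij) e0 dl dlT rm
  C4 t0T jt0 (ltW coll).
by rewrite ltNge Vle.
Qed.
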